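(* Let $\beta\in B_n$ be a braid, let $t>0$, let $G$ be a countable discrete group and let $\gamma:\pi_1(D_n)\to G$ be a homomorphism through which $\phi$ factors. Let $A$ be the $(n\times n)$-matrix whose $(i,j)$ component is $$\kappa(\pi_1(D_n),\phi,\gamma,t)\left(\frac{\partial(h_\beta(x_j))}{\partial x_i}\right)\in\mathbb{C}[G].$$ Then $\mathcal{B}^{(2)}_{t,\gamma}(\beta)=R_A$.
   Context: **Operators.** For a countable discrete group $G$, $\ell^2(G)$ is the Hilbert space of square-summable functions $G\to\mathbb{C}$ and $B(\ell^2(G))$ its algebra of bounded operators. For $h\in G$, $R_h$ is the operator extending $g\mapsto gh$; $R_w$ for $w\in\mathbb{C}[G]$ is defined by linearity, and for a matrix $A=(a_{i,j})$ over $\mathbb{C}[G]$, $R_A=(R_{a_{i,j}})$. Elements of $\ell^2(G)^n$ are column vectors and matrices over $B(\ell^2(G))$ act on the left. **Fox derivatives.** $\partial/\partial x_i:\mathbb{Z}[F_n]\to\mathbb{Z}[F_n]$ is the linear map with $\partial x_j/\partial x_i=\delta_{ij}$, $\partial x_j^{-1}/\partial x_i=-\delta_{ij}x_j^{-1}$ and $\partial(uv)/\partial x_i=\partial u/\partial x_i+u\,\partial v/\partial x_i$ for $u,v\in F_n$. **Braids.** $D_n$ is the closed unit disk with $n$ interior punctures $p_1<\dots<p_n$ on the real axis, $z\in\partial D_n$ a basepoint, and $x_i$ the simple loop at $z$ turning once counterclockwise around $p_i$, so that $\pi_1(D_n)=\pi_1(D_n,z)=F_n$ is free on $x_1,\dots,x_n$.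 The braid group $B_n$ on $n$ strands, with standard generators $\sigma_1,\dots,\sigma_{n-1}$, is identified with the group of isotopy classes of orientation-preserving homeomorphisms of $D_n$ fixing $\partial D^2$ pointwise. If $H_\beta$ represents $\beta$, $h_\beta$ is the induced automorphism of $F_n$; conventions are such that $h_{\alpha\beta}=h_\beta\circ h_\alpha$ and $h_{\sigma_i}(x_i)=x_ix_{i+1}x_i^{-1}$, $h_{\sigma_i}(x_{i+1})=x_i$, $h_{\sigma_i}(x_j)=x_j$ for $j\ne i,i+1$. $\phi:F_n\to\mathbb{Z}$ is the homomorphism $x_i\mapsto1$; $\phi\circ h_\beta=\phi$. **$L^2$-Burau map.** Let $\kappa(\pi_1(D_n),\phi,\gamma,t):\mathbb{Z}[F_n]\to\mathbb{R}[G]$ be the ring homomorphism $g\mapsto t^{\phi(g)}\gamma(g)$; $\ell^2(G)$ is a right $\mathbb{Z}[F_n]$-module via $a\cdot g=R_{\kappa(\pi_1(D_n),\phi,\gamma,t)(g)}(a)$. With $p:\widetilde D_n\to D_n$ the universal cover and $\widetilde z=p^{-1}(z)$, $C_1(\widetilde D_n,\widetilde z)$ ($\cong H_1(\widetilde D_n,\widetilde z;\mathbb{Z})$) is the free left $\mathbb{Z}[F_n]$-module on the lifts $\widetilde x_i$ of the $x_i$ starting at a fixed lift of $z$, and $H_1^{(2)}(D_n,z;\phi,\gamma,t)=\ell^2(G)\otimes_{\mathbb{Z}[F_n]}C_1(\widetilde D_n,\widetilde z)=\bigoplus_{i=1}^n\ell^2(G)\,\widetilde x_i$. The lift $\widetilde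 H_\beta$ of $H_\beta$ fixing the chosen lift of $z$ induces an isomorphism $\mathrm{id}\otimes\widetilde H_\beta: H_1^{(2)}(D_n,z;\phi,\gamma\circ h_\beta,t)\to H_1^{(2)}(D_n,z;\phi,\gamma,t)$; its matrix in the bases $(\widetilde x_i)$ is the $L^2$-Burau map $\mathcal{B}^{(2)}_{t,\gamma}(\beta)\in M_{n,n}(B(\ell^2(G)))$. *)

(* Defs.v *)
From HB Require Import structures.
From mathcomp Require Import all_boot all_order all_algebra.
From mathcomp Require Import generic_quotient ring_quotient.
From mathcomp Require Import freeg complex zify ring lra.
From mathcomp Require Import all_classical all_reals all_analysis.

Set Implicit Arguments.
Unset Strict Implicit.
Unset Printing Implicit Defensive.

Import Order.TTheory GRing.Theory Num.Theory numFieldNormedType.Exports.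

Local Open Scope classical_set_scope.
Local Open Scope quotient_scope.
Local Open Scope ring_scope.

(* Groups given by generators and relations.  A letter (s, false) stands for  *)
(* the generator s and (s, true) for its inverse.                             *)
Definition word (S : choiceType) : choiceType := seq (S * bool).

Definition flip (S : choiceType) (a : S * bool) : S * bool := (a.1, ~~ a.2).

Section Presented.
Context {S : choiceType} (rel : word S -> word S -> Prop).

Inductive pres_eq : word S -> word S -> Prop :=
| pres_refl u : pres_eq u u
| pres_sym u v : pres_eq u v -> pres_eq v u
| pres_trans v u w : pres_eq u v -> pres_eq v w -> pres_eq u w
| pres_cat u u' v v' : pres_eq u u' -> pres_eq v v' -> pres_eq (u ++ v) (u' ++ v')
| pres_flip a : pres_eq [:: a; flip a] [::]
| pres_rel u v : rel u v -> pres_eq u v.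

Definition pres_eqb (u v : word S) : bool := `[< pres_eq u v >].

Lemma pres_eqb_equiv : equiv_class_of pres_eqb.
Proof.
split=> [u|u v|v u w]; first exact/asboolP/pres_refl.
  by apply/asboolP/asboolP => /pres_sym.
by move=> /asboolP uv /asboolP vw; apply/asboolP/(pres_trans uv).
Qed.

Canonical pres_eqb_canonical := EquivRelPack pres_eqb_equiv.

Definition presented := {eq_quot pres_eqb}.
HB.instance Definition _ := Choice.on presented.
HB.instance Definition _ := EqQuotient.on presented.

Lemma pres_piP u v : reflect (pres_eq u v) (\pi_presented u == \pi_presented v).
Proof. by rewrite piE; apply: (iffP idP) => /asboolP. Qed.

Lemma pres_reprP u : pres_eq (repr (\pi_presented u)) u.
Proof. by apply/pres_piP; rewrite reprK. Qed.

Definition pres_of (u : word S) : presented := \pi_presented u.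
Definition pres_mul (x y : presented) := pres_of (repr x ++ repr y).
Definition pres_inv (x : presented) := pres_of (rev (map (@flip S) (repr x))).
Definition gen (s : S) : presented := pres_of [:: (s, false)].

Lemma pres_mulE u v : pres_mul (pres_of u) (pres_of v) = pres_of (u ++ v).
Proof. by apply/eqP/pres_piP/pres_cat; exact: pres_reprP. Qed.

Lemma pres_ind (P : presented -> Prop) :
  (forall u, P (pres_of u)) -> forall x, P x.
Proof. by move=> Pu x; rewrite -[x]reprK; exact: Pu. Qed.

Lemma pres_mulA : associative pres_mul.
Proof.
by elim/pres_ind=> u; elim/pres_ind=> v; elim/pres_ind=> w; rewrite !pres_mulE catA.
Qed.

Lemma pres_mul1 : left_id (pres_of [::]) pres_mul.
Proof. by elim/pres_ind=> u; rewrite pres_mulE. Qed.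

Lemma pres_1mul : right_id (pres_of [::]) pres_mul.
Proof. by elim/pres_ind=> u; rewrite pres_mulE cats0. Qed.

Lemma pres_catV u : pres_eq (u ++ rev (map (@flip S) u)) [::].
Proof.
elim: u => [|a u IH] /=; first exact: pres_refl.
rewrite rev_cons -cats1 catA; apply: pres_trans (pres_flip a).
exact: pres_cat (pres_refl [:: a]) (pres_cat IH (pres_refl [:: flip a])).
Qed.

Lemma pres_Vcat u : pres_eq (rev (map (@flip S) u) ++ u) [::].
Proof.
have {2}-> : u = rev (map (@flip S) (rev (map (@flip S) u))).
  rewrite map_rev revK -map_comp map_id_in // => -[s b] _.
  by rewrite /flip /= negbK.
exact: pres_catV.
Qed.

Lemma pres_mulV : right_inverse (pres_of [::]) pres_inv pres_mul.
Proof. by move=> x; rewrite -{1}[x]reprK pres_mulE; apply/eqP/pres_piP/pres_catV. Qed.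

Lemma pres_Vmul : left_inverse (pres_of [::]) pres_inv pres_mul.
Proof. by move=> x; rewrite -{2}[x]reprK pres_mulE; apply/eqP/pres_piP/pres_Vcat. Qed.

HB.instance Definition _ :=
  isGroup.Build presented pres_mulA pres_mul1 pres_1mul pres_Vmul pres_mulV.

End Presented.

Section WordValue.
Context {S : choiceType} {rel : word S -> word S -> Prop} {K : groupType}.
Variable f : S -> K.

Definition wval (u : word S) : K :=
  (\prod_(a <- u) (if a.2 then (f a.1)^-1 else f a.1))%g.

Definition pres_hom (x : presented rel) : K := wval (repr x).

Lemma wval_eq : (forall u v, rel u v -> wval u = wval v) ->
  forall u v, pres_eq rel u v -> wval u = wval v.
Proof.
move=> frel u v; elim=> {u v} //.
- by move=> v u w _ -> _ ->.
- by move=> u u' v v' _ IHu _ IHv; rewrite /wval !big_cat -!/(wval _) IHu IHv.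
- move=> [s []]; rewrite /wval big_cons big_seq1 big_nil /=.
    by rewrite mulVg.
  by rewrite mulgV.
Qed.

Hypothesis frel : forall u v, rel u v -> wval u = wval v.

Lemma pres_hom_pi u : pres_hom (pres_of rel u) = wval u.
Proof. exact/(wval_eq frel)/pres_reprP. Qed.

Lemma pres_hom_gen s : pres_hom (gen rel s) = f s.
Proof. by rewrite pres_hom_pi /wval big_seq1. Qed.

Lemma pres_homM : {morph pres_hom : x y / (x * y)%g}.
Proof.
elim/(@pres_ind S rel)=> u; elim/(@pres_ind S rel)=> v.
by rewrite [(_ * _)%g]pres_mulE !pres_hom_pi /wval big_cat.
Qed.

End WordValue.

Definition norel (S : choiceType) (u v : word S) : Prop := False.

Notation freegroup n := (@presented 'I_n (@norel 'I_n)).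
Notation fgen i := (gen (@norel _) i).

Definition fhom (n : nat) (K : groupType) (f : 'I_n -> K) : freegroup n -> K :=
  pres_hom f.

Lemma fhom_gen n (K : groupType) (f : 'I_n -> K) i : fhom f (fgen i) = f i.
Proof. exact: pres_hom_gen. Qed.

Lemma fhomM n (K : groupType) (f : 'I_n -> K) : {morph fhom f : x y / (x * y)%g}.
Proof. exact: pres_homM. Qed.

HB.instance Definition _ n (K : groupType) (f : 'I_n -> K) :=
  isMultiplicative.Build (freegroup n) K (fhom f) (fhomM f).

Definition phi (n : nat) (x : freegroup n) : int :=
  \sum_(a <- repr x) (if a.2 then -1 else 1).

Section Braid.
Variable n : nat.

Lemma strand_subproof (i : 'I_n.-1) : (i.+1 < n)%N.
Proof. by case: n i => [[]//|m i] /=; rewrite ltnS. Qed.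

Definition strand (i : 'I_n.-1) : 'I_n := widen_ord (leq_pred n) i.
Definition strandS (i : 'I_n.-1) : 'I_n := Ordinal (strand_subproof i).

Let sigma (i : 'I_n.-1) : 'I_n.-1 * bool := (i, false).

Inductive braid_rel : word 'I_n.-1 -> word 'I_n.-1 -> Prop :=
| braid_comm (i j : 'I_n.-1) : (i.+1 < j)%N ->
    braid_rel [:: sigma i; sigma j] [:: sigma j; sigma i]
| braid_braid (i j : 'I_n.-1) : j = i.+1 :> nat ->
    braid_rel [:: sigma i; sigma j; sigma i] [:: sigma j; sigma i; sigma j].

Definition braid := presented braid_rel.
HB.instance Definition _ := Group.on braid.

(* h_{sigma_i} for the letter (i, false), its inverse for (i, true) *)
Definition artin_letter (a : 'I_n.-1 * bool) : 'I_n -> freegroup n :=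
  let x := fgen (strand a.1) in let y := fgen (strandS a.1) in fun j =>
  if j == strand a.1 then if a.2 then y else (x * y * x^-1)%g
  else if j == strandS a.1 then if a.2 then (y^-1 * x * y)%g else x
  else fgen j.

(* h_{alpha beta} = h_beta \o h_alpha: the first letter acts first *)
Fixpoint artin_word (u : word 'I_n.-1) (x : freegroup n) : freegroup n :=
  if u is a :: v then artin_word v (fhom (artin_letter a) x) else x.

Definition artin (b : braid) : freegroup n -> freegroup n := artin_word (repr b).

End Braid.

Section MorphV.
Variables (G K : groupType) (f : G -> K).
Hypothesis fM : {morph f : x y / (x * y)%g}.

Lemma morphg1 : f 1%g = 1%g.
Proof. by apply: (mulgI (f 1%g)); rewrite -fM !mulg1. Qed.

Lemma morphgV : {morph f : x / x^-1%g}.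
Proof. by move=> x; apply: (mulgI (f x)); rewrite -fM !mulgV morphg1. Qed.
End MorphV.

Lemma pres_of_cons (S : choiceType) (rel : word S -> word S -> Prop) (a : S * bool) u :
  pres_of rel (a :: u) =
  ((if a.2 then (gen rel a.1)^-1 else gen rel a.1) * pres_of rel u)%g.
Proof.
have -> : (if a.2 then (gen rel a.1)^-1 else gen rel a.1)%g = pres_of rel [:: a].
  case: a => i [] //=; apply: (mulgI (gen rel i)); rewrite mulgV.
  rewrite [RHS]pres_mulE; apply/esym/eqP/pres_piP.
  exact: (pres_flip _ (i, false)).
by rewrite [RHS]pres_mulE.
Qed.

Lemma freegroup_ext n (K : groupType) (f g : freegroup n -> K) :
  {morph f : x y / (x * y)%g} -> {morph g : x y / (x * y)%g} ->
  (forall i, f (fgen i) = g (fgen i)) -> f =1 g.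
Proof.
move=> fM gM fg; elim/(@pres_ind _ (@norel 'I_n)); elim=> [|[i b] u IH].
  by rewrite [pres_of _ _]/(1%g : freegroup n) !morphg1.
by rewrite pres_of_cons fM gM IH; case: b; rewrite /= ?morphgV // ?fg.
Qed.

Section ArtinAction.
Variable n : nat.
Implicit Types (a : 'I_n.-1 * bool) (u v : word 'I_n.-1).

Lemma artin_wordM u : {morph artin_word u : x y / (x * y)%g}.
Proof. by elim: u => [//|a u IH] x y /=; rewrite fhomM IH. Qed.

Lemma artin_word_cat u v x : artin_word (u ++ v) x = artin_word v (artin_word u x).
Proof. by elim: u x => [//|a u IH] x /=; exact: IH. Qed.

Let fhomV K f : {morph @fhom n K f : x / x^-1%g}.
Proof. exact/morphgV/fhomM. Qed.

Lemma artin_letter1 a : fhom (artin_letter a) (fgen (strand a.1)) =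
  if a.2 then fgen (strandS a.1)
  else (fgen (strand a.1) * fgen (strandS a.1) * (fgen (strand a.1))^-1)%g.
Proof. by rewrite fhom_gen /artin_letter eqxx. Qed.

Lemma artin_letter2 a : fhom (artin_letter a) (fgen (strandS a.1)) =
  if a.2 then ((fgen (strandS a.1))^-1 * fgen (strand a.1) * fgen (strandS a.1))%g
  else fgen (strand a.1).
Proof.
rewrite fhom_gen /artin_letter eqxx -val_eqE /=.
by rewrite eqn_leq ltnn.
Qed.

Lemma artin_letter3 a (k : 'I_n) : k != a.1 :> nat -> k != a.1.+1 :> nat ->
  fhom (artin_letter a) (fgen k) = fgen k.
Proof.
by move=> k1 k2; rewrite fhom_gen /artin_letter -!val_eqE /= (negbTE k1) (negbTE k2).
Qed.

Lemma artin_word_eq u v : pres_eq (@braid_rel n) u v -> artin_word u =1 artin_word v.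
Proof.
elim=> {u v} [u|u v _ IH|v u w _ IHu _ IHv|u u' v v' _ IHu _ IHv|a|u v].
- by [].
- by move=> x; rewrite IH.
- by move=> x; rewrite IHu IHv.
- by move=> x; rewrite !artin_word_cat IHu IHv.
- apply: freegroup_ext => [||k]; [exact: artin_wordM|exact: artin_wordM|].
  have [/val_inj k1|k1] := eqVneq (k : nat) (strand a.1); last first.
  have [/val_inj k2|k2] := eqVneq (k : nat) (strandS a.1); last first.
  + by rewrite /= !artin_letter3.
  + rewrite k2 /= artin_letter2 /flip; case: a {k k1 k2} => i [] /=.
      rewrite !fhomM fhomV (artin_letter1 (i, false)) (artin_letter2 (i, false)) /=.
      by rewrite !mulgA mulVg mul1g mulgVK.
    by rewrite (artin_letter1 (i, true)).
  + rewrite k1 /= artin_letter1 /flip; case: a {k k1} => i [] /=.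
      by rewrite (artin_letter2 (i, false)).
    rewrite !fhomM fhomV (artin_letter1 (i, true)) (artin_letter2 (i, true)) /=.
    by rewrite !mulgA mulgV mul1g mulgK.
case=> [i j ij|i j ji]; apply: freegroup_ext => [||k];
    [exact: artin_wordM|exact: artin_wordM| |exact: artin_wordM|exact: artin_wordM|].
- move: (artin_letter1 (i, false)) (artin_letter2 (i, false))
    (artin_letter1 (j, false)) (artin_letter2 (j, false)) => /= i1 i2 j1 j2.
  have i3 := @artin_letter3 (i, false); have j3 := @artin_letter3 (j, false).
  have i3j : fhom (artin_letter (i, false)) (fgen (strand j)) = fgen (strand j).
    by rewrite i3 //=; lia.
  have i3j' : fhom (artin_letter (i, false)) (fgen (strandS j)) = fgen (strandS j).
    by rewrite i3 //=; lia.
  have j3i : fhom (artin_letter (j, false)) (fgen (strand i)) = fgen (strand i).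
    by rewrite j3 //=; lia.
  have j3i' : fhom (artin_letter (j, false)) (fgen (strandS i)) = fgen (strandS i).
    by rewrite j3 //=; lia.
  have E := (i1, i2, j1, j2, i3j, i3j', j3i, j3i', fhomM, fhomV).
  have [/val_inj ->|k1] := eqVneq (k : nat) (strand i); first by rewrite /= !E.
  have [/val_inj ->|k2] := eqVneq (k : nat) (strandS i); first by rewrite /= !E.
  have [/val_inj ->|k3] := eqVneq (k : nat) (strand j); first by rewrite /= !E.
  have [/val_inj ->|k4] := eqVneq (k : nat) (strandS j); first by rewrite /= !E.
  by rewrite /= !(i3 k, j3 k).
- have e : strand j = strandS i by exact: val_inj.
  move: (artin_letter1 (i, false)) (artin_letter2 (i, false))
    (artin_letter1 (j, false)) (artin_letter2 (j, false)) => /= i1 i2 j1 j2.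
  rewrite e in j1 j2.
  have i3 := @artin_letter3 (i, false); have j3 := @artin_letter3 (j, false).
  have i3j : fhom (artin_letter (i, false)) (fgen (strandS j)) = fgen (strandS j).
    by rewrite i3 //=; lia.
  have j3i : fhom (artin_letter (j, false)) (fgen (strand i)) = fgen (strand i).
    by rewrite j3 //=; lia.
  have E := (i1, i2, j1, j2, i3j, j3i, fhomM, fhomV).
  have [/val_inj ->|k1] := eqVneq (k : nat) (strand i).
    by rewrite /= !E !invgM !mulgA invgK !mulgVK.
  have [/val_inj ->|k2] := eqVneq (k : nat) (strandS i); first by rewrite /= !E.
  have [/val_inj ->|k4] := eqVneq (k : nat) (strandS j); first by rewrite /= !E.
  have ki : fhom (artin_letter (i, false)) (fgen k) = fgen k by rewrite i3.
  have kj : fhom (artin_letter (j, false)) (fgen k) = fgen k.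
    by rewrite j3 //= ji.
  by rewrite /= !(ki, kj).
Qed.

Lemma artinM (b c : braid n) x : artin (b * c)%g x = artin c (artin b x).
Proof. by rewrite /artin -artin_word_cat; exact/artin_word_eq/pres_reprP. Qed.

Lemma artin_gen i x :
  artin (gen _ i : braid n) x = fhom (artin_letter (i, false)) x.
Proof. exact: artin_word_eq (pres_reprP _ _) x. Qed.

End ArtinAction.

(* Elements of the group ring A[G] are the finite formal sums {freeg G / A}. *)
Section Zlift.
Context {K : choiceType} {M : zmodType} (f : K -> M).

Definition zlift (D : {freeg K / int}) : M := \sum_(k <- dom D) f k *~ coeff k D.

Lemma zliftE D : zlift D = fglift (f : K -> zmodule M) D.
Proof.
rewrite -{2}[D]Freeg_dom fglift_Freeg /prelift big_map.
by apply: eq_bigr.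
Qed.

Lemma zliftB : zmod_morphism zlift.
Proof.
by move=> D1 D2; rewrite !zliftE; exact: (@lift_is_additive int K (zmodule M) f).
Qed.

HB.instance Definition _ :=
  GRing.isZmodMorphism.Build {freeg K / int} M zlift zliftB.

Lemma zliftU k : zlift << k >> = f k.
Proof. by rewrite zliftE liftU scale1r. Qed.

End Zlift.

Lemma zlift_ext (K : choiceType) (M : zmodType) (f g : {freeg K / int} -> M) :
  zmod_morphism f -> zmod_morphism g ->
  (forall k, f << k >> = g << k >>) -> f =1 g.
Proof.
move=> fB gB fg D.
pose f' := GRing.isZmodMorphism.Build _ _ f fB.
pose fA : {additive _ -> _} := HB.pack f f'.
pose g' := GRing.isZmodMorphism.Build _ _ g gB.
pose gA : {additive _ -> _} := HB.pack g g'.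
rewrite -[f]/(fA : _ -> _) -[g]/(gA : _ -> _) -[D]freeg_sumE.
rewrite !raddf_sum; apply: eq_bigr => k _.
have -> : << coeff k D *g k >> = << k >> *~ coeff k D :> {freeg K / int}.
  by rewrite freegU_mulz intz.
by rewrite !raddfMz /= fg.
Qed.

Section Fox.
Variable n : nat.
Local Notation F := (freegroup n).
Local Notation ZF := {freeg (freegroup n) / int}.

Definition ltrans (g : F) : ZF -> ZF := zlift (fun k : F => << (g * k)%g >>).
HB.instance Definition _ g := GRing.Additive.on (ltrans g).

Definition letter (a : 'I_n * bool) : F :=
  if a.2 then (fgen a.1)^-1%g else fgen a.1.

Definition fox_letter (i : 'I_n) (a : 'I_n * bool) : ZF :=
  if a.1 == i then if a.2 then - << (fgen i)^-1%g >> else << 1%g >> else 0.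

Fixpoint fox_word (i : 'I_n) (u : word 'I_n) : ZF :=
  if u is a :: v then fox_letter i a + ltrans (letter a) (fox_word i v) else 0.

Definition fox (i : 'I_n) : ZF -> ZF := zlift (fun g : F => fox_word i (repr g)).
HB.instance Definition _ i := GRing.Additive.on (fox i).

Lemma ltransM (g h : F) D : ltrans (g * h)%g D = ltrans g (ltrans h D).
Proof.
apply: (zlift_ext (f := ltrans _) (g := ltrans g \o ltrans h)) => [||k].
- exact: zliftB.
- by move=> x y; rewrite /= !raddfB.
- by rewrite /ltrans /= !zliftU mulgA.
Qed.

Lemma ltrans1 D : ltrans 1%g D = D.
Proof.
apply: (zlift_ext (f := ltrans _) (g := id)) => [||k]; first exact: zliftB.
- by [].
- by rewrite /ltrans zliftU mul1g.
Qed.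

Lemma fox_word_cat i u v :
  fox_word i (u ++ v) = fox_word i u + ltrans (pres_of (@norel _) u) (fox_word i v).
Proof.
elim: u => [|a u IH] /=; first by rewrite ltrans1 add0r.
by rewrite IH raddfD /= -ltransM addrA pres_of_cons.
Qed.

Lemma fox_word_eq i u v : pres_eq (@norel 'I_n) u v -> fox_word i u = fox_word i v.
Proof.
elim=> {u v} // [v u w _ -> _ ->|u u' v v' uu IHu _ IHv|[j b]] //.
- rewrite !fox_word_cat IHu IHv; congr (_ + ltrans _ _).
  exact/eqP/pres_piP.
rewrite /= raddf0 addr0 /fox_letter /letter /=.
case: (eqVneq j i) => [->|_]; last by rewrite raddf0 addr0.
case: b; rewrite /= ?raddfN /= /ltrans zliftU ?mulg1 ?mulgV ?subrr //.
by rewrite addNr.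
Qed.

Lemma foxE i u : fox i << pres_of (@norel _) u >> = fox_word i u.
Proof. by rewrite /fox zliftU; exact/fox_word_eq/pres_reprP. Qed.

Lemma fox_gen i j : fox i << fgen j >> = if j == i then << 1%g >> else 0.
Proof. by rewrite foxE /= raddf0 addr0. Qed.

Lemma fox_genV i j :
  fox i << (fgen j)^-1%g >> = if j == i then - << (fgen j)^-1%g >> else 0.
Proof.
have -> : (fgen j)^-1%g = pres_of (@norel _) [:: (j, true)].
  by rewrite pres_of_cons /= [pres_of _ _]/(1%g : F) mulg1.
rewrite foxE /= raddf0 addr0 /fox_letter /=; case: eqP => // <-.
by rewrite pres_of_cons /= [pres_of _ _]/(1%g : F) mulg1.
Qed.

Lemma foxM i (g h : F) : fox i << (g * h)%g >> = fox i << g >> + ltrans g (fox i << h >>).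
Proof.
elim/(@pres_ind _ (@norel 'I_n)): g => u; elim/(@pres_ind _ (@norel 'I_n)): h => v.
by rewrite [(_ * _)%g]pres_mulE !foxE fox_word_cat.
Qed.

End Fox.

Section L2.
Variables (R : realType) (G : groupType).
Local Notation C := R[i].
Implicit Types f g : G -> C.

Definition normsq (z : C) : R := complex.Re z ^+ 2 + complex.Im z ^+ 2.

Definition sqnorm (f : G -> C) : \bar R := \esum_(g in [set: G]) (normsq (f g))%:E.

Definition l2pred : {pred G -> C} := fun f => `[< (sqnorm f < +oo)%E >].

Lemma normsq_ge0 z : 0 <= normsq z.
Proof. by rewrite addr_ge0 // sqr_ge0. Qed.

Lemma normsqM z w : normsq (z * w) = normsq z * normsq w.
Proof. by case: z w => [a b] [c d]; rewrite /normsq /=; ring. Qed.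

Lemma normsqD z w : normsq (z + w) <= 2 * normsq z + 2 * normsq w.
Proof.
case: z w => [a b] [c d]; rewrite /normsq /= -subr_ge0.
set e := (X in 0 <= X); have -> : e = (a - c) ^+ 2 + (b - d) ^+ 2 by rewrite /e; ring.
by rewrite addr_ge0 // sqr_ge0.
Qed.

Lemma sqnorm_ge0 f : (0 <= sqnorm f)%E.
Proof. by apply: esum_ge0 => x _; rewrite lee_fin normsq_ge0. Qed.

Lemma esum_scale_le (k : R) (u v : G -> R) : 0 <= k -> (forall x, 0 <= v x) ->
  (forall x, u x <= k * v x) ->
  (\esum_(x in [set: G]) (u x)%:E <= k%:E * \esum_(x in [set: G]) (v x)%:E)%E.
Proof.
move=> k0 v0 uv; apply: ub_ereal_sup => _ [A [finA sA] <-].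
apply: (@le_trans _ _ (\sum_(x \in A) (k%:E * (v x)%:E))%E).
  by apply: lee_fsum => // x _; rewrite -EFinM lee_fin.
rewrite -ge0_mule_fsumr; last by move=> x; rewrite lee_fin.
apply: lee_pmul => //; rewrite ?lee_fin //.
  by apply: fsume_ge0 => // x _; rewrite lee_fin.
by apply: ereal_sup_ubound; exists A.
Qed.

Lemma sqnormD (f g : G -> C) :
  (sqnorm (f \+ g)%R <= 2%:E * sqnorm f + 2%:E * sqnorm g)%E.
Proof.
apply: (@le_trans _ _
  (\esum_(x in [set: G]) ((2 * normsq (f x))%:E + (2 * normsq (g x))%:E))%E).
  by apply: le_esum => x _; rewrite -EFinD lee_fin normsqD.
rewrite esumD; [|by move=> x _; rewrite lee_fin mulr_ge0 // normsq_ge0..].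
by apply: leeD; apply: esum_scale_le => // x; exact: normsq_ge0.
Qed.

Lemma sqnormZ (a : C) f : (sqnorm (a *: f) <= (normsq a)%:E * sqnorm f)%E.
Proof.
by apply: esum_scale_le => [|x|x]; rewrite ?normsq_ge0 // -normsqM.
Qed.

Lemma sqnorm_shift (h : G) f : sqnorm (fun x => f (x * h)%g) = sqnorm f.
Proof.
rewrite /sqnorm [RHS](@reindex_esum R G G setT setT (fun x => x * h)%g) //.
split=> // [x y _ _|y _]; first exact: mulIg.
by exists (y * h^-1)%g; rewrite ?mulgVK.
Qed.

Lemma l2pred_submod : submod_closed l2pred.
Proof.
split=> [|a f g].
  apply/asboolP; rewrite /sqnorm esum1 // => x _.
  by rewrite /normsq /= expr0n /= addr0.
move=> /asboolP f2 /asboolP g2; apply/asboolP.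
have gt1 (k : R) (u : G -> C) : 0 <= k -> (sqnorm u < +oo)%E -> (k%:E * sqnorm u < +oo)%E.
  by move=> k0 u2; rewrite lte_mul_pinfty // lee_fin.
apply: le_lt_trans (sqnormD _ _) _; rewrite lte_add_pinfty // gt1 //.
by apply: le_lt_trans (sqnormZ _ _) _; rewrite gt1 // normsq_ge0.
Qed.

HB.instance Definition _ := GRing.isSubmodClosed.Build C (G -> C) l2pred l2pred_submod.

Record l2 := L2 { l2fun :> G -> C; l2P : l2fun \in l2pred }.
HB.instance Definition _ := [isSub for l2fun].
HB.instance Definition _ := [Choice of l2 by <:].
HB.instance Definition _ := [SubChoice_isSubLmodule of l2 by <:].

Definition bounded_op (T : l2 -> l2) : Prop :=
  linear T /\ exists k : R, forall f : l2, (sqnorm (T f) <= k%:E * sqnorm f)%E.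

Record bop := BOp { bop_fun :> l2 -> l2; bopP : bounded_op bop_fun }.

HB.instance Definition _ := gen_eqMixin bop.
HB.instance Definition _ := gen_choiceMixin bop.

Lemma bop_eqP (S T : bop) : S = T <-> (forall f : l2, S f = T f).
Proof.
split=> [-> //|]; case: S T => [S SP] [T TP] /= /funext eST.
by rewrite -eST in TP *; congr BOp; exact: Prop_irrelevance.
Qed.

(* R_h sends the basis vector g to g * h, hence (R_h f) x = f (x * h^-1) *)
Definition Rsum (s : seq G) (c : G -> C) (f : G -> C) : G -> C :=
  fun x => \sum_(h <- s) c h * f (x * h^-1)%g.

Lemma Rsum_bound s c :
  exists2 k : R, 0 <= k & forall f, (sqnorm (Rsum s c f) <= k%:E * sqnorm f)%E.
Proof.
elim: s => [|h s [k k0 IH]].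
  exists 0 => // f; rewrite mul0e /sqnorm esum1 // => x _.
  by rewrite /Rsum big_nil /normsq /= expr0n /= addr0.
exists (2 * normsq (c h) + 2 * k).
  by rewrite addr_ge0 // mulr_ge0 // normsq_ge0.
move=> f; have -> : Rsum (h :: s) c f =
    (c h *: (fun x => f (x * h^-1)%g)) \+ Rsum s c f.
  by apply/funext => x; rewrite /Rsum big_cons.
apply: le_trans (sqnormD _ _) _.
have -> : ((2 * normsq (c h) + 2 * k)%:E * sqnorm f =
    2%:E * ((normsq (c h))%:E * sqnorm f) + 2%:E * (k%:E * sqnorm f))%E.
  by rewrite !muleA -!EFinM -ge0_muleDl ?lee_fin ?mulr_ge0 ?normsq_ge0.
apply: leeD; apply: lee_wpmul2l; rewrite ?lee_fin //.
by rewrite -(sqnorm_shift h^-1%g f) sqnormZ.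
Qed.

Definition Rfun (w : {freeg G / C}) (f : G -> C) : G -> C :=
  Rsum (dom w) (fun h => coeff h w) f.

Lemma Rfun_l2 w (f : l2) : Rfun w f \in l2pred.
Proof.
have [k k0 bk] := Rsum_bound (dom w) (fun h => coeff h w).
apply/asboolP/(le_lt_trans (bk f)); rewrite lte_mul_pinfty ?lee_fin //.
exact/asboolP/l2P.
Qed.

Lemma Rfun_bounded w : bounded_op (fun f : l2 => L2 (Rfun_l2 w f)).
Proof.
split=> [a f g|].
  apply: val_inj => /=; apply/funext => x; rewrite /Rfun /Rsum /=.
  rewrite !fctE scaler_sumr -big_split; apply: eq_bigr => h _ /=.
  by rewrite mulrDr mulrCA.
have [k k0 bk] := Rsum_bound (dom w) (fun h => coeff h w).
by exists k => f; exact: bk.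
Qed.

Definition Rop (w : {freeg G / C}) : bop := BOp (Rfun_bounded w).

End L2.

Section Paths.
Variables (R : realType) (X : topologicalType).
Local Notation I := (`[0, 1]%classic : set R).

Definition is_path (c : R -> X) (x y : X) : Prop :=
  [/\ {within I, continuous c}, c 0 = x & c 1 = y].

Definition path_homotopic (c d : R -> X) : Prop :=
  exists h : R * R -> X, [/\ {within I `*` I, continuous h},
    forall s, I s -> h (s, 0) = c s, forall s, I s -> h (s, 1) = d s,
    forall t, I t -> h (0, t) = c 0 & forall t, I t -> h (1, t) = c 1].

Definition path_concat (c d : R -> X) (s : R) : X :=
  if s <= 2^-1 then c (2 * s) else d (2 * s - 1).

Definition path_rev (c : R -> X) (s : R) : X := c (1 - s).

Definition simply_connected : Prop :=
  (forall x y, exists c, is_path c x y) /\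
  (forall x c, is_path c x x -> path_homotopic c (cst x)).

(* the loop spelled by a word in the loops x_i based at z *)
Definition word_loop (n : nat) (z : X) (x : 'I_n -> R -> X) (u : word 'I_n) : R -> X :=
  foldr (fun a c => path_concat (if a.2 then path_rev (x a.1) else x a.1) c) (cst z) u.

Definition loop_of n (z : X) (x : 'I_n -> R -> X) (w : freegroup n) : R -> X :=
  word_loop z x (repr w).

End Paths.

Definition covering (E X : topologicalType) (p : E -> X) : Prop :=
  continuous p /\ forall d : X, exists (U : set X) (J : Type) (V : J -> set E),
  [/\ open U /\ U d, forall j, open (V j), trivIset setT V,
      p @^-1` U = \bigcup_j V j &
      forall j, exists s : X -> E, [/\ {within U, continuous s},
        forall u, U u -> V j (s u) /\ p (s u) = u &
        forall e, V j e -> s (p e) = e]].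

Definition homeomorphism (X Y : topologicalType) (h : X -> Y) : Prop :=
  continuous h /\ exists k : Y -> X, [/\ continuous k, cancel h k & cancel k h].

Section Simplices.
Variable R : realType.

Definition stdsimplex (k : nat) : set 'rV[R]_k.+1 :=
  [set v | (forall i, 0 <= v ord0 i) /\ \sum_i v ord0 i = 1].
Arguments stdsimplex : clear implicits.

Definition face_row (k : nat) (i : 'I_k.+2) (v : 'rV[R]_k.+1) : 'rV[R]_k.+2 :=
  \row_j if unlift i j is Some j' then v ord0 j' else 0.

Lemma face_subproof k (i : 'I_k.+2) (v : stdsimplex k) :
  face_row i (\val v) \in stdsimplex k.+1.
Proof.
case: v => v /set_mem [v0 v1] /=; apply/mem_set; split=> [j|].
  by rewrite mxE; case: unliftP.
rewrite (bigD1_ord i) //= mxE unlift_none add0r -[RHS]v1.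
by apply: eq_bigr => j _; rewrite mxE liftK.
Qed.

Definition face k (i : 'I_k.+2) (v : stdsimplex k) : stdsimplex k.+1 :=
  SigSub (face_subproof i v).

Lemma face_continuous k (i : 'I_k.+2) : continuous (@face k i).
Proof.
apply: continuous_comp_initial => v A [P vP PA].
have cval : continuous (set_val : stdsimplex k -> 'rV[R]_k.+1).
  exact: initial_continuous.
suff : nbhs (set_val v) [set w | A (face_row i w)] by move/(cval v).
exists (fun a j => P ord0 (fintype.lift i j)).
  by move=> a j; have := vP ord0 (fintype.lift i j); rewrite /= mxE liftK (ord1 a).
move=> w Pw; apply: PA => /= a j; rewrite (ord1 a) mxE; case: unliftP => [j' ->|ji].
  exact: Pw ord0 j'.
have := nbhs_singleton (vP ord0 j); rewrite /= mxE ji unlift_none; exact.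
Qed.

HB.instance Definition _ k i := isContinuous.Build _ _ (@face k i)
  (@face_continuous k i).

(* the parametrisation of [0, 1] by the standard 1-simplex *)
Definition edge (v : stdsimplex 1) : R := (\val v) ord0 ord_max.

End Simplices.

Arguments stdsimplex : clear implicits.
Arguments face R {k} i v.

Section Singular.
Variables (R : realType).

Local Notation sing k X := (continuousType (stdsimplex R k) X).
Local Notation chain k X := {freeg (sing k X) / int}.

Section Chains.
Variable X : topologicalType.

Definition bnd k : chain k.+1 X -> chain k X :=
  zlift (fun s : sing k.+1 X =>
    \sum_(i < k.+2) << (-1) ^+ i *g (s \o face R i : sing k X) >>).
HB.instance Definition _ k := GRing.Additive.on (@bnd k).

Definition carried k (A : set X) (c : chain k X) : Prop :=
  forall s, s \in dom c -> forall v, A (s v).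

Lemma carriedB k (A : set X) (c d : chain k X) :
  carried A c -> carried A d -> carried A (c - d).
Proof.
move=> Ac Ad s /domB; rewrite mem_cat => /orP[/Ac|/Ad]; exact.
Qed.

Lemma carried0 k (A : set X) : carried A (0 : chain k X).
Proof. by move=> s; rewrite dom0. Qed.

Definition relcycle (A : set X) : {pred chain 1 X} := fun c => `[< carried A (bnd c) >].

Lemma relcycle_zmod (A : set X) : zmod_closed (relcycle A).
Proof.
split=> [|c d /asboolP Ac /asboolP Ad]; apply/asboolP.
  by rewrite raddf0; exact: carried0.
by rewrite raddfB; exact: carriedB.
Qed.

HB.instance Definition _ A :=
  GRing.isZmodClosed.Build (chain 1 X) (relcycle A) (relcycle_zmod A).

Record rel_Z1 (A : set X) := RelZ1 { Z1chain : chain 1 X; Z1P : Z1chain \in relcycle A }.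
HB.instance Definition _ A := [isSub for @Z1chain A].
HB.instance Definition _ A := [Choice of rel_Z1 A by <:].
HB.instance Definition _ A := [SubChoice_isSubZmodule of rel_Z1 A by <:].

Definition rel_B1 (A : set X) : {pred rel_Z1 A} := fun c =>
  `[< exists (d : chain 2 X) (a : chain 1 X), carried A a /\ Z1chain c = bnd d + a >].

Lemma rel_B1_zmod (A : set X) : zmod_closed (@rel_B1 A).
Proof.
split=> [|c d /asboolP[c2 [c1 [Ac ec]]] /asboolP[d2 [d1 [Ad ed]]]]; apply/asboolP.
  by exists 0, 0; rewrite !raddf0 addr0; split=> //; exact: carried0.
exists (c2 - d2), (c1 - d1); split; first exact: carriedB.
have -> : Z1chain (c - d) = Z1chain c - Z1chain d by exact: (raddfB (\val : rel_Z1 A -> _)).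
by rewrite ec ed raddfB opprD addrACA.
Qed.

HB.instance Definition _ A :=
  GRing.isZmodClosed.Build (rel_Z1 A) (@rel_B1 A) (rel_B1_zmod A).

Definition rel_H1 (A : set X) := Quotient.quot (@rel_B1 A : zmodClosed (rel_Z1 A)).
HB.instance Definition _ A := GRing.Zmodule.on (rel_H1 A).
HB.instance Definition _ A := EqQuotient.on (rel_H1 A).

(* insubd gives the junk value 0 when c is not a relative cycle *)
Definition hclass (A : set X) (c : chain 1 X) : rel_H1 A :=
  \pi_(rel_H1 A) (insubd 0 c).

End Chains.

Definition push (X Y : topologicalType) (f : continuousType X Y) k :
    chain k X -> chain k Y :=
  zlift (fun s : sing k X => << (f \o s : sing k Y) >>).

(* evaluated on a representative cycle; meaningful when f maps A to B *)
Definition hpush (X Y : topologicalType) (A : set X) (B : set Y)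
    (f : continuousType X Y) (c : rel_H1 A) : rel_H1 B :=
  hclass B (push f (Z1chain (repr c))).

End Singular.

Section Tensor.
(* The tensor product over S of a right module V and a left module W *)
Context {V W : zmodType} {S : Type} (ra : V -> S -> V) (la : S -> W -> W).
Local Notation free := {freeg (V * W)%type / int}.

Inductive tens_rel : free -> Prop :=
| tens_rel0 : tens_rel 0
| tens_relB u v : tens_rel u -> tens_rel v -> tens_rel (u - v)
| tens_addl a b c : tens_rel (<< (a + b, c) >> - << (a, c) >> - << (b, c) >>)
| tens_addr a c d : tens_rel (<< (a, c + d) >> - << (a, c) >> - << (a, d) >>)
| tens_balance a r c : tens_rel (<< (ra a r, c) >> - << (a, la r c) >>).

Definition tens_relb : {pred free} := fun u => `[< tens_rel u >].

Lemma tens_relb_zmod : zmod_closed tens_relb.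
Proof.
split=> [|u v /asboolP u0 /asboolP v0]; apply/asboolP; first exact: tens_rel0.
exact: tens_relB.
Qed.

HB.instance Definition _ := GRing.isZmodClosed.Build free tens_relb tens_relb_zmod.

Definition tensor := Quotient.quot (tens_relb : zmodClosed free).
HB.instance Definition _ := GRing.Zmodule.on tensor.
HB.instance Definition _ := EqQuotient.on tensor.

Definition pure (a : V) (c : W) : tensor := \pi_tensor << (a, c) >>.

End Tensor.

(* id (x) f, evaluated on a representative; meaningful when f is compatible   *)
(* with the two balancing relations                                          *)
Definition tensor_map (V W W' : zmodType) (S : Type) (ra ra' : V -> S -> V)
    (la : S -> W -> W) (la' : S -> W' -> W') (f : W -> W')
    (u : tensor ra la) : tensor ra' la' :=
  zlift (fun ac : V * W => pure ra' la' ac.1 (f ac.2)) (repr u).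

Section PuncturedDisk.
Variables (R : realType) (n : nat).
Local Notation I := (`[0, 1]%classic : set R).

Definition punctures (p : 'I_n -> R) : Prop :=
  (forall i, -1 < p i < 1) /\ (forall i j : 'I_n, (i < j)%N -> p i < p j).

Definition disk (p : 'I_n -> R) : set (R * R) :=
  [set q | q.1 ^+ 2 + q.2 ^+ 2 <= 1 /\ forall k, q <> (p k, 0)].

Variable p : 'I_n -> R.

Definition boundary (q : disk p) : Prop := (\val q).1 ^+ 2 + (\val q).2 ^+ 2 = 1.

(* c turns k times counterclockwise around q (polar coordinates along c) *)
Definition turns (c : R -> R * R) (q : R * R) (k : int) : Prop :=
  exists theta rho : R -> R, [/\ {within I, continuous theta},
    forall s, I s -> 0 < rho s /\
      c s = (q.1 + rho s * cos (theta s), q.2 + rho s * sin (theta s)) &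
    theta 1 - theta 0 = 2 * pi * k%:~R].

(* The loops x_i: simple, based at z on the boundary, turning once around p_i *)
(* and not around the other punctures; the last two clauses say that          *)
(* w |-> [loop_of z x w] is a bijection from the free group onto pi_1(D_n, z).*)
Definition standard_loops (z : disk p) (x : 'I_n -> R -> disk p) : Prop :=
  [/\ boundary z,
      forall i, is_path (x i) z z /\
        forall s t, 0 <= s < 1 -> 0 <= t < 1 -> x i s = x i t -> s = t,
      forall i j, turns (fun s => \val (x i s)) (p j, 0) (i == j)%:Z,
      forall c, is_path c z z -> exists w, path_homotopic c (loop_of z x w) &
      forall v w, path_homotopic (loop_of z x v) (loop_of z x w) -> v = w].

(* H represents beta.  A homeomorphism fixing the boundary pointwise is       *)
(* automatically orientation-preserving, and its isotopy class is determined  *)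
(* by the automorphism of pi_1(D_n, z) that it induces, so the identification *)
(* of the braid group with the mapping class group is the one for which H     *)
(* induces h_beta.                                                            *)
Definition represents (z : disk p) (x : 'I_n -> R -> disk p)
    (H : disk p -> disk p) (beta : braid n) : Prop :=
  [/\ homeomorphism H, forall q, boundary q -> H q = q &
      forall w, path_homotopic (H \o loop_of z x w) (loop_of z x (artin beta w))].

End PuncturedDisk.

Section Cover.
Variables (R : realType) (n : nat) (X E : topologicalType) (pr : E -> X).
Variables (z : X) (x : 'I_n -> R -> X) (e0 : E).
Local Notation I := (`[0, 1]%classic : set R).

Definition universal_cover : Prop :=
  [/\ covering pr, set_surj setT setT pr & simply_connected R E].

(* the left action by deck transformations: w moves e0 to the endpoint of the *)
(* lift of w starting at e0                                                   *)
Definition deck_action (act : freegroup n -> continuousType E E) : Prop :=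
  [/\ forall e, act 1%g e = e,
      forall u v e, act (u * v)%g e = act u (act v e),
      forall w e, pr (act w e) = pr e &
      forall w, exists c : R -> E, is_path c e0 (act w e0) /\
        forall s, I s -> pr (c s) = loop_of z x w s].

(* a lift starting at e0 of the path c, as a singular 1-simplex *)
Definition simplex_lift (c : R -> X) (s : continuousType (stdsimplex R 1) E) : Prop :=
  (forall v, pr (s v) = c (edge v)) /\ (forall v, edge v = 0 -> s v = e0).

End Cover.

Section Burau.
Variables (R : realType) (n : nat) (G : groupType).
Local Notation C := R[i].
Local Notation F := (freegroup n).
Local Notation ZF := {freeg (freegroup n) / int}.

Definition kappa (gam : F -> G) (t : R) : ZF -> {freeg G / R} :=
  zlift (fun g : F => << t ^ phi g *g gam g >>).

Definition gring_complex (w : {freeg G / R}) : {freeg G / C} :=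
  \sum_(g <- dom w) << (coeff g w)%:C%C *g g >>.

Definition Rmx (A : 'M[{freeg G / C}]_n) : 'M[bop R G]_n := map_mx (@Rop R G) A.

Definition l2act (gam : F -> G) (t : R) (a : l2 R G) (r : ZF) : l2 R G :=
  Rop (gring_complex (kappa gam t r)) a.

Variables (E : topologicalType) (A : set E) (act : F -> continuousType E E).
Local Notation H1 := (rel_H1 R A).

Definition H1act (r : ZF) (c : H1) : H1 := zlift (fun g : F => hpush A (act g) c) r.

(* H_1^(2) = l2(G) (x)_{Z[F_n]} H_1(E, A; Z) *)
Definition H1l2 (gam : F -> G) (t : R) := tensor (l2act gam t) H1act.

Variables (beta : braid n) (Ht : continuousType E E) (e : 'I_n -> H1).
Variables (gam : F -> G) (t : R).

Definition burau_map : H1l2 (gam \o artin beta) t -> H1l2 gam t :=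
  @tensor_map _ _ _ _ _ _ _ _ (hpush A Ht).

(* M is the matrix of burau_map in the bases (e_i) *)
Definition burau_matrix (M : 'M[bop R G]_n) : Prop :=
  forall a : 'I_n -> l2 R G,
    burau_map (\sum_j pure _ _ (a j) (e j)) =
    \sum_i pure _ _ (\sum_j M i j (a j)) (e i).

(* the choice is immaterial: the e_i of interest form a basis, so the matrix  *)
(* is unique                                                                 *)
Definition L2Burau : 'M[bop R G]_n := xget (Rmx 0) [set M | burau_matrix M].

End Burau.

(* Main.v *)
(* The ends of the lifts to E of paths in the punctured disk only depend on   *)
(* homotopy classes, so w |-> w z0 identifies F = F_n with the fibre over z,   *)
(* and the lift of H acts on the fibre as h_beta.  As E is simply connected,   *)
(* H_1(E) = 0 and the boundary map embeds H_1(E, fibre) in Z[fibre] = Z[F]     *)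
(* as a Z[F]-module; it sends the class of the lift of x_i to x_i - 1.  In     *)
(* Z[F] the fundamental formula of Fox calculus reads                          *)
(*     h_beta(x_j) - 1 = sum_i (d h_beta(x_j) / d x_i) (x_i - 1),              *)
(* which expresses the image of the j-th class under the lift of H in terms of *)
(* the others.  Uniqueness of the matrix follows from the functionals          *)
(* a (x) c |-> a . (d c / d x_i): on elements of augmentation 0 the Fox        *)
(* derivative d / d x_i is Z[F]-linear, and it sends x_j - 1 to delta_ij.      *)
Require Import Defs.
From HB Require Import structures.
From mathcomp Require Import all_boot all_order all_algebra.
From mathcomp Require Import generic_quotient ring_quotient.
From mathcomp Require Import freeg complex lra.
From mathcomp Require Import all_classical all_reals all_analysis.

Set Implicit Arguments.
Unset Strict Implicit.
Unset Printing Implicit Defensive.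

Import Order.TTheory GRing.Theory Num.Theory numFieldNormedType.Exports.

Local Open Scope classical_set_scope.
Local Open Scope quotient_scope.
Local Open Scope ring_scope.

(** * Paths and continuity *)

Section Continuity.

(** The problem is carried from relative homology to the group ring [Z[F]], where it becomes the
    fundamental formula of Fox calculus. Geometry serves to build an additive embedding [eta] of
    H_1(E, fibre) in [Z[F]] that turns the deck action into left multiplication, the lift of [x_i]
    into [x_i - 1], and the lift of [H] into the ring endomorphism induced by [artin beta].

    Lifting theory gives the fibre: [act_trans] and [act_free] make [w |-> act w z0] a bijection
    from [F] onto it, [act_gen] locates the end of the lift of [x_i], and [lift_act] computes the
    lift of [H] on it. Homology enters through the connecting map [rel_ends]: it is well defined
    since paths inside the fibre have equal ends, and injective ([rel_ends_inj]) since in a simply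
    connected space every 1-cycle bounds ([ends_eq0_bounds]).

    The rest is algebra with [eta]. By injectivity, [fox_fundamental] yields the image of each basis
    class ([tau_basis]), and moving the Fox derivatives across the tensor sign turns them into
    operators ([fox_matrixE]). As [L2Burau] selects some matrix of the map, uniqueness is also
    needed: Fox derivatives recover coordinates ([basis_coord_inj], [fox_matrix_unique]). *)

Lemma continuous_within_comp (T X Y : topologicalType) (A : set X)
    (f : T -> X) (g : X -> Y) :
  continuous f -> (forall t, A (f t)) -> {within A, continuous g} ->
  continuous (g \o f).
Proof.
move=> cf Af /subspace_continuousP cg t W Wt.
have /cf := cg _ (Af t) W Wt; by apply: (@filterS _ (nbhs t)) => u; apply; exact: Af.
Qed.

Lemma continuous_comp2 (T X Y : topologicalType) (f : T -> X) (g : X -> Y) :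
  continuous f -> continuous g -> continuous (g \o f).
Proof. by move=> cf cg t; apply: continuous_comp; [exact: cf|exact: cg]. Qed.

Lemma continuous_pair (T X Y : topologicalType) (f : T -> X) (g : T -> Y) :
  continuous f -> continuous g -> continuous (fun t => (f t, g t)).
Proof. by move=> cf cg t; apply: cvg_pair; [exact: cf|exact: cg]. Qed.

Variables (R : realType).

Lemma continuous_glue (X : topologicalType) (f g : R -> X) (a : R) :
  continuous f -> continuous g -> f a = g a ->
  continuous (fun r => if r <= a then f r else g r).
Proof.
move=> cf cg fga r; have [ra|ar|->] := ltgtP r a.
- apply: (@cvg_trans _ (f @ r)); last by rewrite (ltW ra); exact: cf.
  apply: near_eq_cvg; near=> s; rewrite ifT //.
  by near: s; exact: lt_le_nbhsl.
- apply: (@cvg_trans _ (g @ r)); last by rewrite leNgt ar; exact: cg.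
  apply: near_eq_cvg; near=> s; rewrite ifF //; apply/negbTE; rewrite -ltNge.
  by near: s; exact: lt_nbhsr.
rewrite /continuous_at lexx => W Wa.
have fW := cf a W Wa; have := cg a W; rewrite -fga => /(_ Wa) gW.
have : nbhs a (f @^-1` W `&` g @^-1` W) by exact: filterI.
by apply: (@filterS _ (nbhs a)) => s [fs gs] /=; case: ifP.
Unshelve. all: by end_near. Qed.

(** Precomposition with [clamp 0 1] makes a path that is continuous on the unit interval continuous
    on the whole line, which dispenses with subspace topologies. *)
Definition clamp (a b r : R) : R := Num.max a (Num.min b r).

Lemma clamp_continuous a b : continuous (clamp a b).
Proof.
move=> r; apply: (@continuous_max R R (cst a) (fun r => Num.min b r)).
  exact: cst_continuous.
apply: (@continuous_min R R (cst b) id); first exact: cst_continuous.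
by [].
Qed.

Lemma clampP a b r : a <= b -> a <= clamp a b r <= b.
Proof. by move=> ab; rewrite /clamp le_max lexx /= ge_max ab ge_min lexx. Qed.

Lemma clamp_id a b r : a <= r <= b -> clamp a b r = r.
Proof. by case/andP=> ar rb; rewrite /clamp (min_idPr rb) (max_idPr ar). Qed.

Local Notation I := (`[0, 1]%classic : set R).

Lemma itv01 (r : R) : I r = (0 <= r <= 1) :> Prop.
Proof. by rewrite /= in_itv. Qed.

Lemma clamp01 r : 0 <= clamp 0 1 r <= 1.
Proof. by apply: clampP; rewrite ler01. Qed.

Lemma within01_clamp (X : topologicalType) (c : R -> X) :
  {within I, continuous c} -> continuous (c \o clamp 0 1).
Proof.
apply: continuous_within_comp; first exact: clamp_continuous.
by move=> r; rewrite itv01 clamp01.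
Qed.

Lemma within01_square_clamp (X : topologicalType) (h : R * R -> X) :
  {within I `*` I, continuous h} ->
  continuous (fun q => h (clamp 0 1 q.1, clamp 0 1 q.2)).
Proof.
apply: continuous_within_comp => [|q]; last by rewrite /= !in_itv /= !clamp01.
apply: continuous_pair; apply: continuous_comp2; try exact: clamp_continuous.
  by move=> q; exact: cvg_fst.
by move=> q; exact: cvg_snd.
Qed.

(** Connectedness of the interval: the local hypothesis is symmetric in [a] and [b], so [P] and its
    complement are both relatively open. *)
Lemma unit_interval_ind (P : R -> Prop) :
  (forall s, 0 <= s <= 1 -> exists2 e, 0 < e &
    forall a b, 0 <= a <= 1 -> 0 <= b <= 1 -> `|s - a| < e -> `|s - b| < e ->
    P a -> P b) ->
  P 0 -> forall s, 0 <= s <= 1 -> P s.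
Proof.
move=> locP P0 s s01.
suff BI : I `&` P = I by have [] : (I `&` P) s by rewrite BI itv01.
apply: (@segment_connected R 0 1); first by exists 0; split; rewrite //= in_itv /= lexx ler01.
- exists (interior [set x | I x -> P x]); first exact: open_interior.
  rewrite predeqE => x; split=> -[Ix]; last first.
    by move=> /interior_subset /(_ Ix).
  move=> Px; split=> //; move: Ix; rewrite itv01 => x01.
  have [e e0 xe] := locP _ x01; apply/nbhs_ballP; exists e => //= y.
  rewrite /ball /= => xy; rewrite in_itv /= => y01; apply: (xe x) => //.
  by rewrite subrr normr0.
- exists (~` interior [set x | I x -> ~ P x]).
    by apply: open_closedC; exact: open_interior.
  rewrite predeqE => x; split=> -[Ix].
    by move=> Px; split=> // /interior_subset /(_ Ix).
  move=> nPx; split=> //; apply: contrapT => Px; apply: nPx.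
  move: Ix; rewrite itv01 => x01.
  have [e e0 xe] := locP _ x01; apply/nbhs_ballP; exists e => //= y.
  rewrite /ball /= => xy; rewrite in_itv /= => y01 Py; apply: Px.
  apply: (xe y) => //; by rewrite subrr normr0.
Qed.

End Continuity.

(** * Lifting in covering spaces *)

Section Covering.
Variables (R : realType) (E X : topologicalType) (p : E -> X).
Hypothesis p_cov : covering p.

(* [V e] is the sheet through [e] and [s e] the local section onto it; both are *)
(* junk when [p e] is not in [U].                                               *)
Lemma covering_sheets (d : X) : exists U (V : E -> set E) (s : E -> X -> E),
  [/\ open U /\ U d,
      forall e, U (p e) -> [/\ open (V e), V e e &
        forall e', V e e' -> s e (p e') = e'],
      forall e u, U (p e) -> U u -> p (s e u) = u,
      forall e u, U (p e) -> U u -> {for u, continuous (s e)} &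
      forall e e' f u, U (p e) -> U (p e') -> V e f -> V e' f -> s e u = s e' u].
Proof.
have [cp /(_ d)[U [J [V [[oU Ud] oV tV pU]]]]] := p_cov.
move=> /choice[s sP].
have inV e : exists j : option J, U (p e) -> exists2 i, j = Some i & V i e.
  have [Ue|] := pselect (U (p e)); last by exists None.
  have : (p @^-1` U) e by []. 
  by rewrite pU => -[j _ Vj]; exists (Some j) => _; exists j.
have [j jP] := choice inV.
exists U, (fun e => if j e is Some i then V i else set0),
  (fun e => if j e is Some i then s i else fun=> e).
split=> //.
- move=> e /jP[i -> Vie]; have [_ _ sV] := sP i.
  by split.
- move=> e u /jP[i -> Vie] Uu; have [_ Us _] := sP i.
  by have [] := Us _ Uu.
- move=> e u /jP[i -> Vie] Uu; have [+ _ _] := sP i.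
  by rewrite continuous_open_subspace // => /(_ u); apply; rewrite inE.
- move=> e e' f u /jP[i -> _] /jP[i' -> _] Vi Vi'.
  suff -> : i = i' by [].
  by apply: tV => //; exists f.
Qed.

Lemma covering_continuous : continuous p.
Proof. by case: p_cov. Qed.

(** Agreement is locally constant: near [s] each lift is a local section applied to the common
    projection, and the two sections coincide once their sheets share a point. *)
Lemma lift_unique (c d : R -> E) : continuous c -> continuous d ->
  (forall r : R, 0 <= r <= 1 -> p (c r) = p (d r)) -> c 0 = d 0 ->
  forall r, 0 <= r <= 1 -> c r = d r.
Proof.
move=> cc cd pcd cd0; apply: unit_interval_ind => // s s01.
have [U [V [f [[oU Us] VP pf _ fe]]]] := covering_sheets (p (c s)).
have Ud : U (p (d s)) by rewrite -pcd.
have [oVc Vcs fc] := VP _ Us.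
have [oVd Vds fd] := VP _ Ud.
have nc : nbhs s (c @^-1` V (c s)) by apply: cc; exact: open_nbhs_nbhs.
have nd : nbhs s (d @^-1` V (d s)) by apply: cd; exact: open_nbhs_nbhs.
have /nbhs_ballP[e e0 sub] : nbhs s (c @^-1` V (c s) `&` d @^-1` V (d s)).
  exact: filterI.
exists e => // a b a01 b01 /sub[/= ca da] /sub[/= cb db] cda.
rewrite -(fc _ cb) -(fd _ db) pcd //.
by apply: (fe _ _ (c a)) => //; rewrite cda.
Qed.

Lemma lift_exists (c : R -> X) (e0 : E) : continuous c -> p e0 = c 0 ->
  exists l : R -> E,
    [/\ continuous l, l 0 = e0 & forall r, 0 <= r <= 1 -> p (l r) = c r].
Proof.
move=> cc pe0.
pose P s := exists l : R -> E,
  [/\ continuous l, l 0 = e0 & forall r, 0 <= r <= s -> p (l r) = c r].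
suff /(_ 1) : forall s, 0 <= s <= 1 -> P s by apply; rewrite lexx ler01.
apply: unit_interval_ind => [s s01|]; last first.
  exists (cst e0); split => //; first exact: cst_continuous.
  by move=> r; rewrite -eq_le => /eqP <-.
have [U [V [f [[oU Us] VP pf fcont _]]]] := covering_sheets (c s).
have nU : nbhs s (c @^-1` U) by apply: cc; exact: open_nbhs_nbhs.
have /nbhs_ballP[e e_gt0 sub] := nU.
exists e => // a b /andP[a0 a1] /andP[b0 b1] sa sb [l [lc l0 pl]].
have [ba|ab] := leP b a.
  exists l; split=> // r /andP[r0 rb]; apply: pl.
  by rewrite r0 (le_trans rb).
have Uab r : U (c (clamp a b r)).
  apply: (sub (clamp a b r)); rewrite /ball /=.
  have /andP[h1 h2] := clampP r (ltW ab).
  move: sa sb; rewrite !ltr_norml => /andP[? ?] /andP[? ?].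
  by apply/andP; split; lra.
have pla : p (l a) = c a by apply: pl; rewrite a0 lexx.
have Ua : U (p (l a)).
  by rewrite pla -[a](@clamp_id _ a b) ?lexx ?ltW //.
have [oV Va fV] := VP _ Ua.
(* Beyond [a] the lift continues by the local section through [l a]. The clamp keeps its argument in
   [U], so this branch is continuous on the whole line. *)
exists (fun r => if r <= a then l r else f (l a) (c (clamp a b r))).
split=> [||r /andP[r0 rb]].
- apply: continuous_glue => //.
    move=> r; apply: (@continuous_comp _ _ _ (fun r => c (clamp a b r)) (f (l a))).
      apply: (@continuous_comp _ _ _ (clamp a b) c); last exact: cc.
      exact: clamp_continuous.
    exact: fcont.
  by rewrite (@clamp_id _ a b) ?lexx ?ltW // -pla fV.
- by rewrite a0.
- have [ra|ar] := leP r a; first by apply: pl; rewrite r0.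
  by rewrite pf // ?(@clamp_id _ a b) // (ltW ar).
Qed.

(* No lift of the whole square is needed.  Lift each horizontal path to [L t].  *)
(* The set of [s] such that [L t s] is continuous in [t] is open and closed, so *)
(* it contains 1; as [L t 1] moves in a discrete fibre, it does not depend on   *)
(* [t].                                                                         *)
Lemma homotopy_lift (h : R * R -> X) (c d : R -> E) :
  continuous h -> (forall t, h (0, t) = h (0, 0)) -> (forall t, h (1, t) = h (1, 0)) ->
  continuous c -> continuous d -> c 0 = d 0 ->
  (forall r : R, 0 <= r <= 1 -> p (c r) = h (r, 0)) ->
  (forall r : R, 0 <= r <= 1 -> p (d r) = h (r, 1)) -> c 1 = d 1.
Proof.
move=> ch h0 h1 cc cd cd0 pc pd.
have i0 : 0 <= (0 : R) <= 1 by rewrite lexx ler01.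
have i1 : 0 <= (1 : R) <= 1 by rewrite lexx ler01.
have hs t : continuous (fun s => h (s, t)).
  by apply: (continuous_comp2 _ ch); apply: continuous_pair => u; [exact: cvg_id|exact: cvg_cst].
have ht s : continuous (fun t => h (s, t)).
  by apply: (continuous_comp2 _ ch); apply: continuous_pair => u; [exact: cvg_cst|exact: cvg_id].
have /choice[L LP] : forall t, exists l : R -> E,
    [/\ continuous l, l 0 = c 0 & forall r, 0 <= r <= 1 -> p (l r) = h (r, t)].
  by move=> t; apply: lift_exists => //; rewrite pc // h0.
have c_L0 : c 1 = L 0 1.
  have [l1 l2 l3] := LP 0.
  by apply: (@lift_unique c (L 0)) => // r r01; rewrite pc // l3.
have d_L1 : d 1 = L 1 1.
  have [l1 l2 l3] := LP 1; apply: (@lift_unique d (L 1)) => //.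
  - by move=> r r01; rewrite pd // l3.
  - by rewrite l2.
rewrite c_L0 d_L1; apply/esym.
suff Lcont t0 : {for t0, continuous (fun t => L t 1)}.
  apply: (@unit_interval_ind R (fun t => L t 1 = L 0 1)) => // s s01.
  have [U [V [f [[oU Us] VP pf _ _]]]] := covering_sheets (h (1, s)).
  have Ls : p (L s 1) = h (1, s) by have [_ _ ->] := LP s.
  have [oV Vs fV] : [/\ open (V (L s 1)), V (L s 1) (L s 1) &
     forall e', V (L s 1) e' -> f (L s 1) (p e') = e'] by apply: VP; rewrite Ls.
  have /nbhs_ballP[e e0 sub] : nbhs s ((fun t => L t 1) @^-1` V (L s 1)).
    by apply: Lcont; exact: open_nbhs_nbhs.
  (* Nearby ends lie in one sheet and over the single point [h (1, 0)], hence coincide. *)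
  have same t : ball s e t -> L t 1 = L s 1.
    move=> /sub /= /fV <-; have [_ _ ->//] := LP t.
    by rewrite h1 -(h1 s) -Ls fV.
  by exists e => // a b _ _ /same -> /same ->.
apply: (@unit_interval_ind R (fun s => {for t0, continuous (fun t => L t s)})) => //.
  move=> s s01.
  have [U [V [f [[oU Us] VP pf fcont _]]]] := covering_sheets (h (s, t0)).
  have /ch/nbhs_ballP[e /= e0 sub] : nbhs (h (s, t0)) U by exact: open_nbhs_nbhs.
  have sub' a t : `|s - a| < e -> `|t0 - t| < e -> U (h (a, t)).
    by move=> sa tt; apply: (sub (a, t)); split.
  exists e => // a b a01 b01 sa sb La.
  have plt t u : 0 <= u <= 1 -> p (L t u) = h (u, t).
    by have [_ _] := LP t; apply.
  have Ua : U (p (L t0 a)) by rewrite plt //; apply: sub'; rewrite // subrr normr0.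
  have [oV Va fV] := VP _ Ua.
  (* Along the segment [k] from [a] to [b], which stays near [s], uniqueness of lifts keeps [L t] on
     the sheet where it was at [a]. *)
  have Lb t : `|t0 - t| < e -> V (L t0 a) (L t a) -> L t b = f (L t0 a) (h (b, t)).
    move=> tt Vt.
    pose k (r : R) := a + clamp 0 1 r * (b - a).
    have k01 r : 0 <= k r <= 1.
      rewrite /k; have := clamp01 r; move: a01 b01; set q := clamp _ _ _.
      move=> /andP[? ?] /andP[? ?] /andP[? ?]; apply/andP; split; nra.
    have kU r : `|s - k r| < e.
      rewrite /k; have := clamp01 r; set q := clamp _ _ _ => /andP[q0 q1].
      move: sa sb; rewrite !ltr_norml => /andP[? ?] /andP[? ?].
      have [ab|/ltW ab] := leP a b.
        have ? : 0 <= q * (b - a) by rewrite mulr_ge0 // subr_ge0.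
        have ? : q * (b - a) <= b - a by rewrite ler_piMl // subr_ge0.
        by apply/andP; split; lra.
      have ? : 0 <= q * (a - b) by rewrite mulr_ge0 // subr_ge0.
      have ? : q * (a - b) <= a - b by rewrite ler_piMl // subr_ge0.
      by apply/andP; split; lra.
    have ck : continuous k.
      move=> r; apply: cvgD; first exact: cvg_cst.
      by apply: cvgM; [exact: clamp_continuous|exact: cvg_cst].
    have k0 : k 0 = a by rewrite /k clamp_id ?mul0r ?addr0.
    have k1 : k 1 = b by rewrite /k clamp_id // mul1r addrC subrK.
    rewrite -k1; apply: (@lift_unique (L t \o k) (fun r => f (L t0 a) (h (k r, t)))) => //.
    - apply: (continuous_comp2 ck); by have [] := LP t.
    - move=> r; apply: (@continuous_comp _ _ _ (fun r => h (k r, t)) (f (L t0 a))).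
        apply: (@continuous_comp _ _ _ k (fun r => h (r, t))); first exact: ck.
        exact: hs.
      by apply: fcont => //; exact: sub'.
    - by move=> r _; rewrite /= plt // pf //; exact: sub'.
    - by rewrite /= k0 -plt // fV.
  have nb : nbhs t0 [set t | L t b = f (L t0 a) (h (b, t))].
    have : nbhs t0 (ball t0 e `&` (fun t => L t a) @^-1` V (L t0 a)).
      apply: filterI; first exact: nbhsx_ballx.
      by apply: La; exact: open_nbhs_nbhs.
    by apply: (@filterS _ (nbhs t0)) => t [te Vt]; exact: Lb.
  change ((fun t => L t b) @ t0 --> L t0 b); have -> : L t0 b = f (L t0 a) (h (b, t0)).
    exact: (nbhs_singleton nb).
  apply: (@cvg_trans _ ((fun t => f (L t0 a) (h (b, t))) @ t0)).
    by apply: near_eq_cvg; move: nb; apply: (@filterS _ (nbhs t0)) => t /= ->.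
  apply: (@continuous_comp _ _ _ (fun t => h (b, t)) (f (L t0 a))); first exact: ht.
  by apply: fcont => //; apply: sub' => //; rewrite subrr normr0.
suff -> : (fun t => L t 0) = cst (c 0) by exact: cst_continuous.
by apply/funext => t; have [_ ->] := LP t.
Qed.

End Covering.

(** * Paths and homotopies in a simply connected space *)

Section Paths.
Variables (R : realType) (X : topologicalType).
Implicit Types (c d : R -> X) (f : R -> R).
Local Notation I := (`[0, 1]%classic : set R).

Lemma is_path_clamp c a b : is_path c a b ->
  [/\ continuous (c \o clamp 0 1), (c \o clamp 0 1) 0 = a & (c \o clamp 0 1) 1 = b].
Proof.
case=> cc <- <-; split; first exact: within01_clamp.
  by rewrite /= clamp_id // lexx ler01.
by rewrite /= clamp_id // lexx ler01.
Qed.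

Lemma continuous_is_path c : continuous c -> is_path c (c 0) (c 1).
Proof. by move=> cc; split=> //; exact: continuous_subspaceT. Qed.

Lemma is_path_comp (Y : topologicalType) (f : X -> Y) c a b :
  continuous f -> is_path c a b -> is_path (f \o c) (f a) (f b).
Proof.
move=> cf [cc <- <-]; split=> //; apply/subspace_continuousP => r Ir.
apply: (@cvg_comp _ _ _ c f); last exact: cf.
by move/subspace_continuousP : cc; exact.
Qed.

Lemma affine_continuous (a b : R) : continuous (fun r : R => a * r + b).
Proof.
move=> r; apply: cvgD; last exact: cvg_cst.
by apply: cvgM; [exact: cvg_cst|exact: cvg_id].
Qed.

Lemma path_concat_continuous c d : continuous c -> continuous d -> c 1 = d 0 ->
  continuous (path_concat c d).
Proof.
move=> cc cd cd10; apply: continuous_glue.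
- apply: (@continuous_comp2 R R _ (fun r => 2 * r) c _ cc).
  by move=> r; apply: cvgM; [exact: cvg_cst|exact: cvg_id].
- apply: (@continuous_comp2 R R _ (fun r => 2 * r - 1) d _ cd).
  exact: affine_continuous.
- by rewrite divff // subrr.
Qed.

Lemma path_concat0 c d : path_concat c d 0 = c 0.
Proof. by rewrite /path_concat invr_ge0 ler0n mulr0. Qed.

Lemma path_concat1 c d : path_concat c d 1 = d 1.
Proof.
rewrite /path_concat ifF; first by congr d; lra.
by apply/negbTE; rewrite -ltNge; lra.
Qed.

Lemma path_rev_continuous c : continuous c -> continuous (path_rev c).
Proof.
move=> cc; apply: (@continuous_comp2 R R _ (fun r => 1 - r) c _ cc).
by move=> r; apply: cvgB; [exact: cvg_cst|exact: cvg_id].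
Qed.

(* The null-homotopy [h] of [c d^-1] is a map of the square that is constant on *)
(* three sides.  The homotopy from [c] to [d] follows, for each time [t], the   *)
(* straight segment of the square that ends at the middle [(1/2, 0)] of the     *)
(* fourth side and starts at the point reached at time [t] by a path running    *)
(* along the three other sides.                                                 *)
Lemma simply_connected_homotopy c d : simply_connected R X ->
  continuous c -> continuous d -> c 0 = d 0 -> c 1 = d 1 ->
  exists k : R * R -> X, [/\ continuous k,
    forall s, 0 <= s <= 1 -> k (s, 0) = c s,
    forall s, 0 <= s <= 1 -> k (s, 1) = d s,
    forall t, k (0, t) = c 0 & forall t, k (1, t) = c 1].
Proof.
move=> [_ scX] cc cd cd0 cd1.
pose l := path_concat c (path_rev d).
have lc : continuous l.
  apply: path_concat_continuous => //; first exact: path_rev_continuous.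
  by rewrite /path_rev subr0.
have l0 : l 0 = c 0 by rewrite /l path_concat0.
have l1 : l 1 = c 0 by rewrite /l path_concat1 /path_rev subrr.
have /scX[h [hc hb ht h0 h1]] : is_path l (c 0) (c 0).
  by have := continuous_is_path lc; rewrite l0 l1.
(* As [t] runs through the three thirds of the interval, [(A t, B t)] goes up the left side of the
   square, along the top and down the right side. *)
pose A (t : R) := clamp 0 1 (3 * t - 1).
pose B (t : R) := clamp 0 1 (Num.min (3 * t) (3 - 3 * t)).
have cA : continuous A.
  apply: (@continuous_comp2 R R _ (fun t => 3 * t - 1) (clamp 0 1)).
    exact: affine_continuous.
  exact: clamp_continuous.
have cB : continuous B.
  apply: (@continuous_comp2 R R _ (fun t => Num.min (3 * t) (3 - 3 * t)) (clamp 0 1)).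
    move=> t; apply: (@continuous_min R R (fun t => 3 * t) (fun t => 3 - 3 * t)).
      by apply: cvgM; [exact: cvg_cst|exact: cvg_id].
    apply: cvgB; first exact: cvg_cst.
    by apply: cvgM; [exact: cvg_cst|exact: cvg_id].
  exact: clamp_continuous.
pose phi (q : R * R) := ((1 - q.1) * A q.2 + q.1 / 2, (1 - q.1) * B q.2).
have cphi : continuous phi.
  have c1 : continuous (fun q : R * R => 1 - q.1).
    by move=> q; apply: cvgB; [exact: cvg_cst|exact: cvg_fst].
  have cf2 (f : R -> R) : continuous f -> continuous (fun q : R * R => f q.2).
    by move=> cf; apply: (@continuous_comp2 (R * R)%type R R snd f) => // q; exact: cvg_snd.
  apply: continuous_pair => q.
    apply: cvgD; first by apply: cvgM; [exact: c1|exact: cf2].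
    by apply: cvgM; [exact: cvg_fst|exact: cvg_cst].
  by apply: cvgM; [exact: c1|exact: cf2].
have I01 (r : R) : 0 <= r <= 1 -> I r by move=> r01; rewrite itv01.
exists (fun q => h (clamp 0 1 (phi q).1, clamp 0 1 (phi q).2)); split.
- exact: (continuous_comp2 cphi (within01_square_clamp hc)).
- move=> s /andP[s0 s1]; rewrite /phi /= /A /B mulr0 sub0r subr0.
  have -> : clamp 0 1 (-1) = 0 :> R.
    by rewrite /clamp (min_idPr _) ?(max_idPl _) //; lra.
  rewrite (min_idPl _); last by lra.
  rewrite (@clamp_id _ 0 1 0) ?lexx ?ler01 // !mulr0 add0r.
  rewrite (@clamp_id _ 0 1 0) ?lexx ?ler01 //.
  rewrite clamp_id; last by apply/andP; split; lra.
  rewrite hb; last by apply: I01; apply/andP; split; lra.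
  by rewrite /l /path_concat ifT; [congr c; lra|lra].
- move=> s /andP[s0 s1]; rewrite /phi /= /A /B mulr1.
  have -> : clamp 0 1 (3 - 1) = 1 :> R.
    by rewrite /clamp (min_idPl _) ?(max_idPr _) //; lra.
  rewrite (min_idPr _); last by lra.
  rewrite subrr (@clamp_id _ 0 1 0) ?lexx ?ler01 // mulr0.
  rewrite (@clamp_id _ 0 1 0) ?lexx ?ler01 //.
  rewrite clamp_id; last by apply/andP; split; lra.
  rewrite hb; last by apply: I01; apply/andP; split; lra.
  rewrite /l /path_concat; case: ifPn => [s2|_].
    have -> : s = 1 by lra.
    by rewrite -cd1; congr c; lra.
  by rewrite /path_rev; congr d; lra.
- move=> t; rewrite /phi /= subr0 !mul1r mul0r addr0.
  have A01 := clamp01 (3 * t - 1); have B01 := clamp01 (Num.min (3 * t) (3 - 3 * t)).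
  rewrite !clamp_id //.
  have [t3|t3] := leP (3 * t) 1.
    have -> : A t = 0 by rewrite /A /clamp (min_idPr _) ?(max_idPl _) //; lra.
    by rewrite h0 // I01.
  have [t6|t6] := leP 2 (3 * t).
    have -> : A t = 1 by rewrite /A /clamp (min_idPl _) ?(max_idPr _) //; lra.
    by rewrite h1 // I01.
  have -> : B t = 1.
    rewrite /B /clamp (min_idPl _) ?(max_idPr _) ?ler01 //.
    by rewrite le_min; apply/andP; split; lra.
  by rewrite ht // I01.
- move=> t; rewrite /phi /= subrr !mul0r add0r.
  rewrite (@clamp_id _ 0 1 0) ?lexx ?ler01 //.
  rewrite clamp_id; last by apply/andP; split; lra.
  rewrite hb; last by apply: I01; apply/andP; split; lra.
  by rewrite /l /path_concat ifT; [congr c; lra|lra].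
Qed.

End Paths.

(** * The fibre over the basepoint as a copy of the free group *)

Section Deck.
Variables (R : realType) (n : nat) (X E : topologicalType) (pr : E -> X).
Variables (z : X) (x : 'I_n -> R -> X) (z0 : E).
Variable act : freegroup n -> continuousType E E.
Local Notation I := (`[0, 1]%classic : set R).

Hypothesis pr_cov : covering pr.
Hypothesis x_loop : forall i, is_path (x i) z z.
Hypothesis pr_z0 : pr z0 = z.
Hypothesis act_deck : deck_action pr z x z0 act.

Definition lifts (c : R -> X) (a b : E) :=
  exists l : R -> E, is_path l a b /\ forall r, I r -> pr (l r) = c r.

Lemma liftsW c a b : lifts c a b -> exists l : R -> E,
  [/\ continuous l, l 0 = a, l 1 = b & forall r, 0 <= r <= 1 -> pr (l r) = c r].
Proof.
move=> [l [lab pl]]; have [lc l0 l1] := is_path_clamp lab.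
exists (l \o clamp 0 1); split=> // r r01.
by rewrite /= clamp_id // pl // itv01.
Qed.

Lemma path_homotopic_lifts (c d : R -> X) a b b' : path_homotopic c d ->
  lifts c a b -> lifts d a b' -> b = b'.
Proof.
move=> [h [hc hc0 hd h0 h1]] /liftsW[l [lc l0 <- pl]] /liftsW[k [kc k0 <- pk]].
have I0 : I 0 by rewrite itv01 lexx ler01.
have I1 : I 1 by rewrite itv01 lexx ler01.
have Ic r : I (clamp 0 1 r) by rewrite itv01 clamp01.
have c0 : clamp 0 1 0 = 0 :> R by rewrite clamp_id // -itv01.
have c1 : clamp 0 1 1 = 1 :> R by rewrite clamp_id // -itv01.
apply: (homotopy_lift pr_cov (within01_square_clamp hc)) => //=; rewrite ?l0 ?k0 //.
- by move=> t; rewrite !c0 !h0.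
- by move=> t; rewrite !c1 !h1.
- by move=> r r01; rewrite c0 clamp_id // hc0 ?pl // itv01.
- by move=> r r01; rewrite c1 clamp_id // hd ?pk // itv01.
Qed.

Lemma lifts_inj (c : R -> X) a b b' : lifts c a b -> lifts c a b' -> b = b'.
Proof.
move=> /liftsW[l [lc l0 <- pl]] /liftsW[k [kc k0 <- pk]].
apply: (lift_unique pr_cov) => //; rewrite ?l0 ?k0 ?lexx ?ler01 //.
by move=> r r01; rewrite pl // pk.
Qed.

Definition letter_loop (a : 'I_n * bool) := if a.2 then path_rev (x a.1) else x a.1.

Lemma letter_loop_ends a : letter_loop a 0 = z /\ letter_loop a 1 = z.
Proof.
have [_ x0 x1] := x_loop a.1.
by rewrite /letter_loop /path_rev; case: a.2; rewrite ?subr0 ?subrr.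
Qed.

Lemma word_loop0 u : word_loop z x u 0 = z.
Proof.
case: u => [//|a u]; rewrite [LHS]path_concat0; exact: (letter_loop_ends a).1.
Qed.

(* [loop_of] spells a representative chosen by [repr]; unlike the loops spelled *)
(* by words, the relation below is visibly compatible with [pres_eq].           *)
Fixpoint transport (u : word 'I_n) (a b : E) : Prop :=
  if u is l :: v then exists2 c, lifts (letter_loop l) a c & transport v c b
  else a = b.

Lemma lifts_transport u a b : lifts (word_loop z x u) a b -> transport u a b.
Proof.
elim: u a b => [|l u IH] a b /=.
  move=> /liftsW[k [kc <- <- pk]].
  apply: (lift_unique pr_cov (d := k) (c := cst (k 0))) => //.
  - exact: cst_continuous.
  - by move=> r r01; rewrite pk //= pk //= lexx ler01.
  - by rewrite lexx ler01.
move=> /liftsW[k [kc ka kb pk]]; exists (k 2^-1).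
  exists (fun r => k (2^-1 * r)); split.
    rewrite -ka -[in X in is_path _ X](mulr0 2^-1) -[in X in is_path _ _ X](mulr1 2^-1).
    apply: (@continuous_is_path _ _ (fun r => k (2^-1 * r))).
    apply: (@continuous_comp2 R R _ (fun r => 2^-1 * r) k _ kc).
    by move=> r; apply: cvgM; [exact: cvg_cst|exact: cvg_id].
  move=> r; rewrite itv01 => /andP[r0 r1]; rewrite pk; last first.
    by apply/andP; split; lra.
  rewrite [LHS]/(path_concat _ _ _) /path_concat ifT; last by lra.
  by rewrite mulrA divff // mul1r.
apply: IH; exists (fun r => k (2^-1 * r + 2^-1)); split.
  have e1 : 2^-1 = 2^-1 * 0 + 2^-1 :> R by lra.
  have e2 : 1 = 2^-1 * 1 + 2^-1 :> R by lra.
  rewrite -kb [in X in is_path _ X]e1 [in X in is_path _ _ X]e2.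
  apply: (@continuous_is_path _ _ (fun r => k (2^-1 * r + 2^-1))).
  apply: (@continuous_comp2 R R _ (fun r => 2^-1 * r + 2^-1) k _ kc).
  exact: affine_continuous.
move=> r; rewrite itv01 => /andP[r0 r1]; rewrite pk; last first.
  by apply/andP; split; lra.
(* The midpoint belongs to the first branch of [path_concat]; both branches equal [z] there. *)
rewrite [LHS]/(path_concat _ _ _) /path_concat; case: ifPn => [r2|_].
  have -> : r = 0 by lra.
  rewrite word_loop0 mulr0 add0r divff //; exact: (letter_loop_ends l).2.
by congr word_loop; lra.
Qed.

Lemma transport_cat u v a b :
  transport (u ++ v) a b <-> exists2 c, transport u a c & transport v c b.
Proof.
elim: u a => [|l u IH] a /=; first by split=> [?|[c <-//]]; exists a.
split=> [[c ac /IH[d cd db]]|[d [c ac cd] db]].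
  by exists d => //; exists c.
by exists c => //; apply/IH; exists d.
Qed.

Lemma transport_fiber u a b : transport u a b -> pr a = z -> pr b = z.
Proof.
elim: u a => [a <-//|l u IH] a /= [c ac cb] _; apply: IH cb _.
move: ac => /liftsW[k [_ _ <- ->]]; last by rewrite lexx ler01.
exact: (letter_loop_ends l).2.
Qed.

Lemma transport_inj u a b b' : transport u a b -> transport u a b' -> b = b'.
Proof.
elim: u a => [a <- //|l u IH] a /= [c ac cb] [c' ac' cb'].
by apply: IH cb _; rewrite (lifts_inj ac ac').
Qed.

Lemma lifts_flip l a b : lifts (letter_loop l) a b -> lifts (letter_loop (flip l)) b a.
Proof.
move=> /liftsW[k [kc <- <- pk]]; exists (path_rev k); split.
  have := continuous_is_path (path_rev_continuous kc).
  by rewrite /path_rev subr0 subrr.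
move=> r; rewrite itv01 => /andP[r0 r1]; rewrite /path_rev pk; last first.
  by apply/andP; split; lra.
case: l {pk} => i []; rewrite /letter_loop /flip /path_rev //=; congr (x i); lra.
Qed.

Lemma lifts_letter l a : pr a = z -> exists b, lifts (letter_loop l) a b.
Proof.
move=> az; have [xc x0 x1] := x_loop l.1.
pose y := x l.1 \o clamp 0 1; have yc : continuous y by exact: within01_clamp.
pose c := if l.2 then path_rev y else y.
have cE (r : R) : 0 <= r <= 1 -> c r = letter_loop l r.
  move=> /andP[r0 r1]; rewrite /c /letter_loop /path_rev /y /=.
  by case: l.2; rewrite /= clamp_id //; apply/andP; split; lra.
have cc : continuous c by rewrite /c; case: l.2 => //; exact: path_rev_continuous.
have [|k [kc k0 pk]] := lift_exists pr_cov (e0 := a) cc.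
  by rewrite cE ?lexx ?ler01 // (letter_loop_ends l).1.
exists (k 1), k; rewrite -k0; split; first exact: continuous_is_path.
by move=> r; rewrite itv01 => r01; rewrite pk // cE.
Qed.

(** For a cancelling pair, the reverse of a lift leads back to its start. That some lift starts at
    [a] is where [pr a = z] enters. *)
Lemma transport_eq u v : pres_eq (@norel 'I_n) u v ->
  forall a b, pr a = z -> (transport u a b <-> transport v a b).
Proof.
elim=> {u v} [u|u v _ IH|v u w _ IHu _ IHv|u u' v v' _ IHu _ IHv|l|u v []] a b az.
- by split.
- by have [] := IH a b az.
- exact: iff_trans (IHu a b az) (IHv a b az).
- rewrite !transport_cat; split=> -[c ac cb]; have cz := transport_fiber ac az.
    by exists c; [exact/(IHu a c az)|exact/(IHv c b cz)].
  by exists c; [exact/(IHu a c az)|exact/(IHv c b cz)].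
- split=> /= [[c ac [d cd <-]]|<-]; first exact: lifts_inj (lifts_flip ac) cd.
  have [c ac] := lifts_letter l az; exists c => //; exists a => //.
  exact: lifts_flip.
Qed.

Lemma lifts_act w : lifts (loop_of z x w) z0 (act w z0).
Proof. by have [_ _ _ /(_ w)[c []]] := act_deck; exists c. Qed.

(** [act (fgen i)] is known only through the loop of a representative of [fgen i], possibly longer
    than one letter; [transport] compares the two spellings. *)
Lemma act_gen i a : lifts (x i) z0 a -> a = act (fgen i) z0.
Proof.
move=> xa; apply: (@transport_inj [:: (i, false)] z0).
  by exists a.
apply/(transport_eq (pres_reprP _ _)) => //.
exact: (lifts_transport (lifts_act _)).
Qed.

Hypothesis E_sc : simply_connected R E.
Hypothesis loops_surj :
  forall c, is_path c z z -> exists w, path_homotopic c (loop_of z x w).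
Hypothesis loops_inj :
  forall v w, path_homotopic (loop_of z x v) (loop_of z x w) -> v = w.

(** A path in [E] from [z0] to [a] projects to a loop, which is homotopic to the loop of some
    word. *)
Lemma act_trans a : pr a = z -> exists w, act w z0 = a.
Proof.
move=> az; have [c ca] := E_sc.1 z0 a.
have /loops_surj[w cw] : is_path (pr \o c) z z.
  by rewrite -{1}pr_z0 -az; exact: is_path_comp (covering_continuous pr_cov) ca.
exists w; apply/esym; apply: path_homotopic_lifts cw _ (lifts_act w).
by exists c.
Qed.

(** Lifts with common ends are homotopic in the simply connected [E], and the homotopy projects to
    one between the loops. *)
Lemma act_free v w : act v z0 = act w z0 -> v = w.
Proof.
move=> vw; apply: loops_inj.
have /liftsW[c [cc c0 c1 pc]] := lifts_act v.
have /liftsW[d [cd d0 d1 pd]] := lifts_act w.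
have [k [kc kb kt k0 k1]] := @simply_connected_homotopy R E c d E_sc cc cd
  (etrans c0 (esym d0)) (etrans c1 (etrans vw (esym d1))).
have pr_act u : pr (act u z0) = z by have [_ _ ->] := act_deck.
exists (pr \o k); split=> [||||].
- apply: continuous_subspaceT; apply: (continuous_comp2 kc).
  exact: (covering_continuous pr_cov).
- by move=> s; rewrite itv01 => s01; rewrite /= kb // pc.
- by move=> s; rewrite itv01 => s01; rewrite /= kt // pd.
- by move=> t _; rewrite /= k0 -pc // lexx ler01.
- by move=> t _; rewrite /= k1 -pc // lexx ler01.
Qed.

(** [Ht] carries the lift of [w] to a lift of its image under [H], a loop homotopic to that of
    [h w]. *)
Lemma lift_act (H : X -> X) (Ht : E -> E) (h : freegroup n -> freegroup n) w :
  (forall w, path_homotopic (H \o loop_of z x w) (loop_of z x (h w))) ->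
  continuous Ht -> (forall e, pr (Ht e) = H (pr e)) -> Ht z0 = z0 ->
  Ht (act w z0) = act (h w) z0.
Proof.
move=> Hh cHt prHt Ht0; apply: path_homotopic_lifts (Hh w) _ (lifts_act _).
have [c [cw pc]] := lifts_act w; exists (Ht \o c); split.
  by rewrite -{1}Ht0; exact: is_path_comp.
by move=> r Ir; rewrite /= prHt pc.
Qed.

End Deck.

(** * Singular chains of a simply connected space *)

Section Zlift.
Variables (K L : choiceType) (M : zmodType).

Lemma freeg_int_ind (P : {freeg K / int} -> Prop) :
  P 0 -> (forall u v, P u -> P v -> P (u - v)) -> (forall k, P << k >>) ->
  forall u, P u.
Proof.
move=> P0 PB PU u.
have PN v : P v -> P (- v) by move=> Pv; rewrite -sub0r; exact: PB.
have PD v w : P v -> P w -> P (v + w).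
  by move=> Pv Pw; rewrite -[w]opprK; apply: PB => //; exact: PN.
have PMn v m : P v -> P (v *+ m).
  by move=> Pv; elim: m => [//|m IH]; rewrite mulrS; exact: PD.
rewrite -[u]freeg_sumE; apply: (big_ind P) => // k _.
have -> : << coeff k u *g k >> = << k >> *~ coeff k u :> {freeg K / int}.
  by rewrite freegU_mulz intz.
case: (coeff k u) => m; first exact: PMn.
by apply: PN; exact: PMn.
Qed.

Lemma zlift_comp (f : L -> M) (g : K -> L) u :
  zlift f (zlift (fun k => << g k >>) u) = zlift (f \o g) u.
Proof.
move: u; apply: zlift_ext => [u v|u v|k]; rewrite ?raddfB //.
by rewrite !zliftU.
Qed.

Lemma eq_in_zlift (f g : K -> M) u :
  (forall k, k \in dom u -> f k = g k) -> zlift f u = zlift g u.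
Proof. by move=> fg; apply: eq_big_seq => k ku; rewrite fg. Qed.

Lemma zlift_id (u : {freeg K / int}) : zlift (fun k => << k >>) u = u.
Proof. by move: u; apply: zlift_ext => [u v|u v|k]; rewrite ?raddfB ?zliftU. Qed.

Lemma deg_zlift (f : K -> L) (u : {freeg K / int}) :
  deg (zlift (fun k => << f k >> : {freeg L / int}) u) = deg u.
Proof.
elim/freeg_int_ind: u => [|u v eu ev|k]; first by rewrite !raddf0.
  by rewrite !raddfB /= eu ev.
by rewrite zliftU !degU.
Qed.

End Zlift.

Fact square_relation (V : zmodType) (k0 k1 g c d : V) :
  k1 - g + c - k1 - (d - g + k0 - k0) = c - d.
Proof.
rewrite addrK opprB -(addrA k1) [_ - k1]addrC addKr [- g + c]addrC.
by rewrite addrA subrK.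
Qed.

Fact triangle_relation (V : zmodType) (a b c : V) : a - b - (a - c) + (b - c) = 0.
Proof.
by rewrite opprB addrACA subrK addrAC subrr sub0r subrr.
Qed.

Fact concat_relation (V : zmodType) (p a b s : V) :
  p - b - (p - a - s) = s - (b - a).
Proof. by rewrite !opprB addrC -addrA; congr (_ + _); rewrite addrA subrK. Qed.

(** * Paths and squares as singular simplices *)

Section Simplices.
Variables (R : realType) (E : topologicalType).
Local Notation sing k := (continuousType (stdsimplex R k) E).
Local Notation chain k := {freeg (sing k) / int}.

Lemma coord_continuous_simplex k (i : 'I_k.+1) :
  continuous (fun v : stdsimplex R k => (\val v) ord0 i).
Proof.
move=> v; apply: (@continuous_comp _ _ _ set_val (fun w : 'rV[R]_k.+1 => w ord0 i)).
  exact: initial_continuous.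
exact: coord_continuous.
Qed.

Lemma edge_continuous : continuous (@edge R).
Proof. exact: coord_continuous_simplex. Qed.

Lemma edge01 (v : stdsimplex R 1) : 0 <= edge v <= 1.
Proof.
case: v => v vP; have [v0 v1] := set_mem vP; rewrite /edge /=.
move: v1; rewrite 2!big_ord_recl big_ord0 addr0.
have := v0 ord0; have := v0 ord_max.
rewrite (_ : fintype.lift ord0 ord0 = ord_max); last exact: val_inj.
by move=> *; apply/andP; split; lra.
Qed.

Definition point_row (r : R) : 'rV[R]_2 :=
  \row_j if j == ord_max then clamp 0 1 r else 1 - clamp 0 1 r.

Lemma point_subproof r : point_row r \in stdsimplex R 1.
Proof.
have /andP[c0 c1] := clamp01 r; apply/mem_set; split=> [i|].
  by rewrite mxE; case: ifP => _ //; lra.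
by rewrite 2!big_ord_recl big_ord0 !mxE /=; lra.
Qed.

Definition edge_point r : stdsimplex R 1 := SigSub (point_subproof r).

Lemma edge_point_continuous : continuous edge_point.
Proof.
apply: continuous_comp_initial => r A [P rP PA].
have cr : continuous (fun r : R => clamp 0 1 r) by exact: clamp_continuous.
have : nbhs r [set s | P ord0 ord_max (clamp 0 1 s) /\ P ord0 ord0 (1 - clamp 0 1 s)].
  apply: filterI.
    by apply: cr; have := rP ord0 ord_max; rewrite /= mxE eqxx.
  have c1 : continuous (fun s : R => 1 - clamp 0 1 s).
    by move=> s; apply: cvgB; [exact: cvg_cst|exact: cr].
  by apply: c1; have := rP ord0 ord0; rewrite /= mxE.
apply: (@filterS _ (nbhs r)) => s [Ps1 Ps0]; apply: PA => /= a j.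
rewrite (ord1 a) mxE; case: ifPn => [/eqP ->//|].
case: j => [[|[|//]] jP] // _.
by rewrite (_ : Ordinal jP = ord0) //; exact: val_inj.
Qed.

Lemma edge_pointK r : 0 <= r <= 1 -> edge (edge_point r) = r.
Proof. by move=> r01; rewrite /edge /= mxE eqxx clamp_id. Qed.

Lemma edgeK v : edge_point (edge v) = v.
Proof.
apply: val_inj; apply/rowP => j; rewrite /= mxE clamp_id ?edge01 //.
case: eqP => [->//|].
case: j => [[|[|//]] jP] //.
  move=> _; case: v => v vP; have [_] := set_mem vP; rewrite /edge /=.
  rewrite 2!big_ord_recl big_ord0 addr0 => <-.
  rewrite (_ : fintype.lift ord0 ord0 = ord_max); last exact: val_inj.
  rewrite (_ : Ordinal jP = ord0); last exact: val_inj.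
  by rewrite addrK.
by case; exact: val_inj.
Qed.

Definition simplex_path (s : sing 1) (r : R) : E := s (edge_point r).

Lemma simplex_path_continuous s : continuous (simplex_path s).
Proof. exact: (continuous_comp2 edge_point_continuous (@cts_fun _ _ s)). Qed.

Definition path_simplex (c : R -> E) (cc : continuous c) : sing 1 :=
  mkcts (continuous_comp2 edge_continuous cc).

Lemma eq_path_simplex (c d : R -> E) (cc : continuous c) (cd : continuous d) :
  (forall r, 0 <= r <= 1 -> c r = d r) -> path_simplex cc = path_simplex cd.
Proof. by move=> cd1; apply/continuousEP => v; exact: cd1 (edge01 v). Qed.

Lemma simplex_pathK s : path_simplex (@simplex_path_continuous s) = s.
Proof. by apply/continuousEP => v; rewrite /= /mkcts /= /simplex_path edgeK. Qed.

Lemma face_lift k (i : 'I_k.+2) (v : stdsimplex R k) j :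
  (\val (face R i v)) ord0 (fintype.lift i j) = (\val v) ord0 j.
Proof. by rewrite /= mxE liftK. Qed.

Lemma face_skip k (i : 'I_k.+2) (v : stdsimplex R k) :
  (\val (face R i v)) ord0 i = 0.
Proof. by rewrite /= mxE unlift_none. Qed.

(** The vertices of the triangle go to [(0, 0)], [(1, 0)] and [(0, 1)]. *)
Definition square_simplex (f : R * R -> E) (cf : continuous f) : sing 2 :=
  mkcts (continuous_comp2 (continuous_pair (@coord_continuous_simplex 2 1)
    (@coord_continuous_simplex 2 2%:R)) cf).

Lemma simplex1_sum (v : stdsimplex R 1) : (\val v) ord0 ord0 = 1 - edge v.
Proof.
case: v => v vP; have [_] := set_mem vP; rewrite /edge /=.
rewrite 2!big_ord_recl big_ord0 addr0 => <-.
by rewrite (_ : fintype.lift ord0 ord0 = ord_max) ?addrK //; exact: val_inj.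
Qed.

Lemma bnd_simplex k (s : sing k.+1) :
  bnd << s >> = \sum_(i < k.+2) << (-1) ^+ i *g (s \o face R i : sing k) >>.
Proof. exact: zliftU. Qed.

Lemma bnd1 (s : sing 1) : bnd << s >> =
  << (s \o face R ord0 : sing 0) >> - << (s \o face R ord_max : sing 0) >>.
Proof.
rewrite bnd_simplex 2!big_ord_recl big_ord0 addr0 expr0 expr1 freegUN.
by rewrite (_ : fintype.lift ord0 ord0 = ord_max) //; exact: val_inj.
Qed.

Lemma bnd2 (s : sing 2) : bnd << s >> =
  << (s \o face R 0 : sing 1) >> - << (s \o face R 1 : sing 1) >>
  + << (s \o face R 2%:R : sing 1) >>.
Proof.
rewrite bnd_simplex 3!big_ord_recl big_ord0 addr0 expr0 expr1 addrA freegUN.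
rewrite (_ : fintype.lift ord0 ord0 = 1); last exact: val_inj.
rewrite (_ : fintype.lift ord0 (fintype.lift ord0 ord0) = 2%:R); last exact: val_inj.
by rewrite sqrrN expr1n.
Qed.

Lemma bnd_square_simplex (f : R * R -> E) (cf : continuous f)
    (a b c : R -> E) (ca : continuous a) (cb : continuous b) (cc : continuous c) :
  (forall r, 0 <= r <= 1 -> f (1 - r, r) = a r) ->
  (forall r, 0 <= r <= 1 -> f (0, r) = b r) ->
  (forall r, 0 <= r <= 1 -> f (r, 0) = c r) ->
  bnd << square_simplex cf >> =
  << path_simplex ca >> - << path_simplex cb >> + << path_simplex cc >>.
Proof.
move=> fa fb fc; rewrite bnd2.
have E0 : square_simplex cf \o face R 0 = path_simplex ca :> sing 1.
  apply/continuousEP => v; rewrite /= /mkcts /= -fa ?edge01 // -simplex1_sum.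
  congr (f (_, _)).
    rewrite (_ : 1 = fintype.lift 0 ord0); [exact: face_lift|exact: val_inj].
  rewrite (_ : 2%:R = fintype.lift 0 ord_max); [exact: face_lift|exact: val_inj].
have E1 : square_simplex cf \o face R 1 = path_simplex cb :> sing 1.
  apply/continuousEP => v; rewrite /= /mkcts /= -fb ?edge01 //.
  congr (f (_, _)); first exact: face_skip.
  rewrite (_ : 2%:R = fintype.lift 1 ord_max); [exact: face_lift|exact: val_inj].
have E2 : square_simplex cf \o face R 2%:R = path_simplex cc :> sing 1.
  apply/continuousEP => v; rewrite /= /mkcts /= -fc ?edge01 //.
  congr (f (_, _)); last exact: face_skip.
  rewrite (_ : 1 = fintype.lift 2%:R ord_max); [exact: face_lift|exact: val_inj].
by rewrite E0 E1 E2.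
Qed.

Definition bounds k (c : chain k) : Prop := exists d : chain k.+1, c = bnd d.

Lemma bounds0 k : bounds (0 : chain k).
Proof. by exists 0; rewrite raddf0. Qed.

Lemma boundsB k (c d : chain k) : bounds c -> bounds d -> bounds (c - d).
Proof. by move=> [u ->] [v ->]; exists (u - v); rewrite raddfB. Qed.

(** The three equal edges of a constant triangle carry signs +, -, +, so one survives. *)
Lemma bounds_cst e : bounds << path_simplex (@cst_continuous R E e) >>.
Proof.
exists << square_simplex (@cst_continuous (R * R)%type E e) >>.
pose ce := @cst_continuous R E e.
rewrite (bnd_square_simplex _ ce ce ce) //. by rewrite subrr add0r.
Qed.

(** The concatenation, composed with the affine map taking the vertices to 0, 1/2 and 1, is a
    triangle with edges [c], [d] and the concatenation. *)
Lemma bounds_concat (c d : R -> E) (cc : continuous c) (cd : continuous d)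
    (cd10 : c 1 = d 0) :
  bounds (<< path_simplex (path_concat_continuous cc cd cd10) >>
    - << path_simplex cc >> - << path_simplex cd >>).
Proof.
pose cl := path_concat_continuous cc cd cd10.
have cf : continuous (fun q : R * R => path_concat c d (2^-1 * q.1 + q.2)).
  apply: (@continuous_comp2 (R * R)%type R E (fun q => 2^-1 * q.1 + q.2) _ _ cl).
  move=> q; apply: cvgD; last exact: cvg_snd.
  by apply: cvgM; [exact: cvg_cst|exact: cvg_fst].
exists (- << square_simplex cf >>).
rewrite raddfN /= (bnd_square_simplex cf cd cl cc).
- by rewrite opprD opprB addrAC.
- move=> r /andP[r0 r1] /=; rewrite /path_concat; case: ifPn => [r2|_].
    have -> : r = 0 by lra.
    by rewrite -cd10; congr c; lra.
  by congr d; lra.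
- by move=> r _ /=; rewrite mulr0 add0r.
- move=> r /andP[r0 r1] /=; rewrite /path_concat ifT; last by lra.
  by congr c; lra.
Qed.

(** The diagonal [k (r, r)] cuts the homotopy into two triangles; their remaining edges are [c], [d]
    and constants, and the constants bound. *)
Lemma bounds_homotopic (c d : R -> E) (cc : continuous c) (cd : continuous d) :
  simply_connected R E -> c 0 = d 0 -> c 1 = d 1 ->
  bounds (<< path_simplex cc >> - << path_simplex cd >>).
Proof.
move=> scE cd0 cd1.
have [k [kc kb kt k0 k1]] := simply_connected_homotopy scE cc cd cd0 cd1.
have c1 : continuous (fun q : R * R => k (q.1 + q.2, q.2)).
  apply: (continuous_comp2 _ kc); apply: continuous_pair => q; last exact: cvg_snd.
  by apply: cvgD; [exact: cvg_fst|exact: cvg_snd].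
have c2 : continuous (fun q : R * R => k (q.2, q.1 + q.2)).
  apply: (continuous_comp2 _ kc); apply: continuous_pair => q; first exact: cvg_snd.
  by apply: cvgD; [exact: cvg_fst|exact: cvg_snd].
have ckd : continuous (fun r => k (r, r)).
  by apply: (continuous_comp2 _ kc); apply: continuous_pair => q; exact: cvg_id.
have B1 : bounds (<< path_simplex (@cst_continuous R E (c 1)) >>
    - << path_simplex ckd >> + << path_simplex cc >>).
  exists << square_simplex c1 >>.
  rewrite (bnd_square_simplex c1 (@cst_continuous R E (c 1)) ckd cc) //= => r r01.
  - by rewrite subrK k1.
  - by rewrite add0r.
  - by rewrite addr0 kb.
have B2 : bounds (<< path_simplex cd >> - << path_simplex ckd >>
    + << path_simplex (@cst_continuous R E (c 0)) >>).
  exists << square_simplex c2 >>.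
  rewrite (bnd_square_simplex c2 cd ckd (@cst_continuous R E (c 0))) //= => r r01.
  - by rewrite subrK kt.
  - by rewrite add0r.
have := boundsB (boundsB B1 (bounds_cst (c 1))) (boundsB B2 (bounds_cst (c 0))).
congr bounds; exact: square_relation.
Qed.

(** The boundary of a 1-chain, with 0-simplices read as points of [E]. *)
Definition ends : chain 1 -> {freeg E / int} :=
  zlift (fun s : sing 1 => << simplex_path s 1 >> - << simplex_path s 0 >>).
HB.instance Definition _ := GRing.Additive.on ends.

Lemma ends_simplex s : ends << s >> = << simplex_path s 1 >> - << simplex_path s 0 >>.
Proof. exact: zliftU. Qed.

Lemma vertex_subproof k (i : 'I_k.+1) : delta_mx ord0 i \in stdsimplex R k.
Proof.
apply/mem_set; split=> [j|]; first by rewrite mxE ler0n.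
rewrite (bigD1 i) //= mxE !eqxx big1 ?addr0 // => j ji.
by rewrite mxE (negbTE ji) andbF.
Qed.

Definition vertex k (i : 'I_k.+1) : stdsimplex R k := SigSub (vertex_subproof i).

Lemma simplex0E (v : stdsimplex R 0) : v = vertex ord0.
Proof.
apply: val_inj; apply/rowP => j; rewrite (ord1 j) !mxE eqxx /=.
by case: v => v vP /=; have [_ <-] := set_mem vP; rewrite big_ord1.
Qed.

Lemma face_vertex k (i : 'I_k.+2) j : face R i (vertex j) = vertex (fintype.lift i j).
Proof.
apply: val_inj; apply/rowP => l; rewrite !mxE /=.
case: unliftP => [l' ->|->]; first by rewrite mxE (inj_eq (@lift_inj _ i)).
by rewrite (negbTE (neq_lift _ _)).
Qed.

Lemma edge_point0 : edge_point 0 = vertex ord0.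
Proof.
apply: val_inj; apply/rowP => l; rewrite !mxE /= clamp_id ?lexx ?ler01 // subr0.
by case: l => [[|[|//]] lP].
Qed.

Lemma edge_point1 : edge_point 1 = vertex ord_max.
Proof.
apply: val_inj; apply/rowP => l; rewrite !mxE /= clamp_id ?lexx ?ler01 // subrr.
by case: l => [[|[|//]] lP].
Qed.

Lemma ends_bnd d : ends (bnd d) = 0.
Proof.
elim/freeg_int_ind: d => [|u v eu ev|s]; first by rewrite !raddf0.
  by rewrite !raddfB /= eu ev subrr.
rewrite bnd2 raddfD raddfB /= !ends_simplex /simplex_path /=.
rewrite edge_point0 edge_point1 !face_vertex.
rewrite (_ : fintype.lift 1 ord0 = fintype.lift 2%:R ord0); last exact: val_inj.
rewrite (_ : fintype.lift 1 ord_max = fintype.lift 0 ord_max); last exact: val_inj.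
rewrite (_ : fintype.lift 2%:R ord_max = fintype.lift 0 ord0); last exact: val_inj.
exact: triangle_relation.
Qed.

Lemma ends_bnd1 c :
  ends c = zlift (fun s : sing 0 => << s (vertex ord0) >>) (bnd c).
Proof.
elim/freeg_int_ind: c => [|u v eu ev|s]; first by rewrite !raddf0.
  by rewrite !raddfB /= eu ev.
rewrite bnd1 raddfB /= !zliftU /= !face_vertex ends_simplex /simplex_path.
rewrite edge_point0 edge_point1.
by congr (<< s (vertex _) >> - << s (vertex _) >>); exact: val_inj.
Qed.

Lemma deg_ends c : deg (ends c) = 0.
Proof.
elim/freeg_int_ind: c => [|u v eu ev|s]; first by rewrite !raddf0.
  by rewrite !raddfB /= eu ev subrr.
by rewrite ends_simplex raddfB /= !degU subrr.
Qed.

(* In a simply connected space a path is homologous to the difference of two of *)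
(* the chosen paths from [e0] to its ends, so a chain is determined up to a     *)
(* boundary by the boundary of each of its simplices.                           *)
Lemma ends_eq0_bounds (e0 : E) c : simply_connected R E -> ends c = 0 -> bounds c.
Proof.
move=> scE.
have /choice[P PP] (e : E) : exists l : R -> E,
    [/\ continuous l, l 0 = e0 & l 1 = e].
  by have [l /is_path_clamp[lc l0 l1]] := scE.1 e0 e; exists (l \o clamp 0 1).
have Pc e : continuous (P e) by have [] := PP e.
pose PL := zlift (fun e => << path_simplex (Pc e) >> : chain 1).
(* In this form, free of the condition [ends c = 0], the claim is additive in [c] and can be checked
   on simplices. *)
suff cP : bounds (c - PL (ends c)).
  by move=> c0; move: cP; rewrite c0 /PL raddf0 subr0.
elim/freeg_int_ind: c => [|u v eu ev|s].
- by rewrite /PL !raddf0 addr0; exact: bounds0.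
- have := boundsB eu ev; congr bounds.
  by rewrite /PL !raddfB /= addrACA.
rewrite ends_simplex /PL raddfB /= !zliftU.
have sc := @simplex_path_continuous s.
have [_ P00 P01] := PP (simplex_path s 0).
have [_ P10 P11] := PP (simplex_path s 1).
have B1 := bounds_concat (Pc (simplex_path s 0)) sc P01.
have B2 := bounds_homotopic (path_concat_continuous (Pc (simplex_path s 0)) sc P01)
  (Pc (simplex_path s 1)) scE.
rewrite path_concat0 path_concat1 P00 P10 P11 in B2.
have := boundsB (B2 erefl erefl) B1; congr bounds.
have sE : path_simplex sc = s by rewrite -[RHS]simplex_pathK; exact: eq_path_simplex.
rewrite sE; exact: concat_relation.
Qed.

End Simplices.

(** * The connecting map of the pair (E, A) *)

Section RelativeHomology.
Variables (R : realType) (E : topologicalType) (A : set E).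
Local Notation sing k := (continuousType (stdsimplex R k) E).
Local Notation chain k := {freeg (sing k) / int}.
Local Notation H1 := (rel_H1 R A).

Hypothesis A_discrete : forall c : R -> E, continuous c ->
  (forall r, 0 <= r <= 1 -> A (c r)) -> c 0 = c 1.

Lemma ends_carried (c : chain 1) : carried A c -> ends c = 0.
Proof.
move=> Ac; rewrite /ends (@eq_in_zlift _ _ _ (fun=> 0)) => [|s /Ac As].
  by rewrite /zlift big1 // => s _; rewrite mul0rz.
apply/eqP; rewrite subr_eq0; apply/eqP; congr << _ >>; apply/esym.
apply: A_discrete; first exact: simplex_path_continuous.
by move=> r _; exact: As.
Qed.

Lemma Z1chainB (c d : rel_Z1 R A) : Z1chain (c - d) = Z1chain c - Z1chain d.
Proof. exact: (raddfB (\val : rel_Z1 R A -> _)). Qed.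

Definition rel_ends (u : H1) : {freeg E / int} := ends (Z1chain (repr u)).

Lemma rel_ends_pi (c : rel_Z1 R A) : rel_ends (\pi_(rel_H1 R A) c) = ends (Z1chain c).
Proof.
have : repr (\pi_(rel_H1 R A) c) - c \in @rel_B1 R E A.
  by rewrite Quotient.idealrBE reprK.
move=> /asboolP[d [a [Aa e]]]; apply/eqP; rewrite -subr_eq0 -raddfB.
have -> : Z1chain (repr (\pi_(rel_H1 R A) c)) - Z1chain c = bnd d + a.
  by rewrite -e Z1chainB.
by rewrite raddfD /= ends_bnd add0r ends_carried.
Qed.

Lemma rel_endsB : zmod_morphism rel_ends.
Proof.
move=> u v; rewrite -[u]reprK -[v]reprK -[_ - _]raddfB !rel_ends_pi.
by rewrite Z1chainB raddfB.
Qed.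

HB.instance Definition _ := GRing.isZmodMorphism.Build _ _ rel_ends rel_endsB.

Lemma hclassK (c : chain 1) : c \in relcycle A -> rel_ends (hclass A c) = ends c.
Proof. by move=> cA; rewrite /hclass rel_ends_pi insubdK. Qed.

(** Injectivity part of the exact sequence of the pair: a relative cycle with zero ends is an honest
    boundary. *)
Lemma rel_ends_inj (e0 : E) : simply_connected R E -> injective rel_ends.
Proof.
move=> scE u v uv; apply/eqP; rewrite -subr_eq0; apply/eqP.
move/eqP: uv; rewrite -subr_eq0 -raddfB => /eqP; move: (u - v) => {u v} u.
rewrite /rel_ends => /(ends_eq0_bounds e0 scE)[d cd].
have : repr u - 0 \in @rel_B1 R E A.
  rewrite subr0; apply/asboolP; exists d, 0; split; first exact: carried0.
  by rewrite addr0.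
by rewrite Quotient.idealrBE reprK => /eqP ->; exact: raddf0.
Qed.

Lemma deg_rel_ends u : deg (rel_ends u) = 0.
Proof. exact: deg_ends. Qed.

(** The boundary of a relative cycle is carried by [A], so values off [A] are irrelevant. *)
Lemma eq_zlift_rel_ends (M : zmodType) (f g : E -> M) u :
  (forall e, A e -> f e = g e) -> zlift f (rel_ends u) = zlift g (rel_ends u).
Proof.
move=> fg; rewrite /rel_ends ends_bnd1 !zlift_comp; apply: eq_in_zlift => s su.
have /asboolP Au := Z1P (repr u); exact: fg (Au s su _).
Qed.

(** The end conditions make the simplex a relative cycle, so [hclass] does not fall back on its
    default value. *)
Lemma hclass_simplex (s : sing 1) : A (simplex_path s 0) -> A (simplex_path s 1) ->
  rel_ends (hclass A << s >>) = << simplex_path s 1 >> - << simplex_path s 0 >>.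
Proof.
move=> A0 A1; rewrite hclassK ?ends_simplex //; apply/asboolP.
rewrite bnd1; apply: carriedB => f; rewrite domU1 inE => /eqP -> v /=.
  rewrite (simplex0E v) face_vertex.
  by rewrite (_ : fintype.lift _ _ = ord_max) -?edge_point1 //; exact: val_inj.
rewrite (simplex0E v) face_vertex.
by rewrite (_ : fintype.lift _ _ = ord0) -?edge_point0 //; exact: val_inj.
Qed.

Lemma push_bnd (f : continuousType E E) k (c : chain k.+1) :
  bnd (push f c) = push f (bnd c) :> chain k.
Proof.
rewrite /push; elim/freeg_int_ind: c => [|u v eu ev|s].
- by rewrite !raddf0.
- by rewrite !raddfB /= eu ev.
rewrite zliftU !bnd_simplex raddf_sum; apply: eq_bigr => i _.
have U (m : int) (t : sing k) : << m *g t >> = << t >> *~ m :> chain k.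
  by rewrite freegU_mulz intz.
rewrite U [in RHS]U raddfMz /= zliftU; congr (<< _ >> *~ _).
exact/continuousEP.
Qed.

Lemma ends_push (f : continuousType E E) (c : chain 1) :
  ends (push f c) = zlift (fun e => << f e >>) (ends c).
Proof.
rewrite /push; elim/freeg_int_ind: c => [|u v eu ev|s].
- by rewrite !raddf0.
- by rewrite !raddfB /= eu ev.
by rewrite zliftU !ends_simplex raddfB /= !zliftU.
Qed.

Lemma carried_push (f : continuousType E E) k (c : chain k) :
  (forall e, A e -> A (f e)) -> carried A c -> carried A (push f c).
Proof.
move=> Af Ac s; rewrite /push /zlift => /dom_sum_subset /flattenP[_ /mapP[t + ->]].
rewrite mem_filter /= => tc.
rewrite freegU_mulz intz => st v.
have := Ac t tc v; move/Af; suff -> : s = f \o t by [].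
move: st; have [->|c0] := eqVneq (coeff t c) 0; first by rewrite freegU0 dom0.
by rewrite domU // inE => /eqP.
Qed.

Lemma rel_ends_hpush (f : continuousType E E) u : (forall e, A e -> A (f e)) ->
  rel_ends (hpush A f u) = zlift (fun e => << f e >>) (rel_ends u).
Proof.
move=> Af; rewrite /hpush hclassK ?ends_push //; apply/asboolP.
by rewrite push_bnd; apply: carried_push => //; exact/asboolP/(Z1P (repr u)).
Qed.

End RelativeHomology.

(** * Fox calculus *)

Section GroupRing.
Variable n : nat.
Local Notation F := (freegroup n).
Local Notation ZF := {freeg (freegroup n) / int}.
Implicit Types (g h w : F) (r s y : ZF).

Definition gmul r y : ZF := zlift (fun g => ltrans g y) r.

Lemma gmulBl r s y : gmul (r - s) y = gmul r y - gmul s y.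
Proof. exact: zliftB. Qed.

Lemma gmulDl r s y : gmul (r + s) y = gmul r y + gmul s y.
Proof. by rewrite /gmul raddfD. Qed.

Lemma gmulNl r y : gmul (- r) y = - gmul r y.
Proof. by rewrite /gmul raddfN. Qed.

Lemma gmul0l y : gmul 0 y = 0.
Proof. by rewrite /gmul raddf0. Qed.

Lemma gmulU g y : gmul << g >> y = ltrans g y.
Proof. exact: zliftU. Qed.

Lemma ltransU g h : ltrans g << h >> = << (g * h)%g >>.
Proof. exact: zliftU. Qed.

Lemma gmul_ltrans g r y : gmul (ltrans g r) y = ltrans g (gmul r y).
Proof.
elim/freeg_int_ind: r => [|u v eu ev|h].
- by rewrite raddf0 !gmul0l raddf0.
- by rewrite raddfB !gmulBl raddfB /= eu ev.
- by rewrite ltransU !gmulU ltransM.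
Qed.

Lemma pres_of_nil : pres_of (@norel 'I_n) [::] = 1%g.
Proof. by []. Qed.

(** Induction on a word: by the product rule the sum for [a u] is
    [(a - 1) + a (u - 1) = a u - 1]. *)
Lemma fox_fundamental w :
  \sum_i gmul (fox i << w >>) (<< fgen i >> - << 1%g >>) = << w >> - << 1%g >>.
Proof.
elim/(@pres_ind _ (@norel 'I_n)): w; elim=> [|a u IH].
  rewrite pres_of_nil subrr big1 // => i _.
  by rewrite -pres_of_nil foxE /= gmul0l.
rewrite pres_of_cons -/(letter a).
under eq_bigr => i _ do rewrite foxM gmulDl gmul_ltrans.
rewrite big_split /= -raddf_sum IH raddfB /= !ltransU mulg1 addrC.
suff -> : \sum_i gmul (fox i << letter a >>) (<< fgen i >> - << 1%g >>) =
    << letter a >> - << 1%g >> :> ZF by rewrite addrA subrK.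
case: a {IH} => j b; rewrite (bigD1 j) //= big1 ?addr0 => [|i ij].
  case: b; rewrite /letter /= ?fox_gen ?fox_genV eqxx.
    by rewrite gmulNl gmulU raddfB /= !ltransU mulVg mulg1 opprB.
  by rewrite gmulU ltrans1.
by case: b; rewrite /letter /= ?fox_gen ?fox_genV eq_sym (negbTE ij) gmul0l.
Qed.

(* Without the assumption, the term [deg y *: fox i << g >>] has to be added.   *)
Lemma fox_ltrans i g y : deg y = 0 -> fox i (ltrans g y) = ltrans g (fox i y).
Proof.
move=> y0; rewrite -[RHS]add0r -(mulr0z (fox i << g >>)) -y0 {y0}.
elim/freeg_int_ind: y => [|u v eu ev|h].
- by rewrite !raddf0 addr0.
- by rewrite !raddfB /= eu ev opprD addrACA.
- by rewrite ltransU foxM degU mulr1z.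
Qed.

Lemma fox_gmul i r y : deg y = 0 -> fox i (gmul r y) = gmul r (fox i y).
Proof.
move=> y0; elim/freeg_int_ind: r => [|u v eu ev|g].
- by rewrite !gmul0l raddf0.
- by rewrite !gmulBl raddfB /= eu ev.
- by rewrite !gmulU fox_ltrans.
Qed.

End GroupRing.

(** * Invariance of the exponent sum under braids *)

Section Phi.
Variable n : nat.
Local Notation F := (freegroup n).

Definition word_phi (u : word 'I_n) : int := \sum_(a <- u) (if a.2 then -1 else 1).

Lemma word_phi_eq u v : pres_eq (@norel 'I_n) u v -> word_phi u = word_phi v.
Proof.
elim=> {u v} // [v u w _ -> _ ->|u u' v v' _ IHu _ IHv|[i b]] //.
  by rewrite /word_phi !big_cat -!/(word_phi _) IHu IHv.
by rewrite /word_phi big_cons big_seq1 big_nil; case: b.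
Qed.

Lemma phi_pres_of u : phi (pres_of (@norel 'I_n) u) = word_phi u.
Proof. exact: word_phi_eq (pres_reprP _ _). Qed.

Lemma phiM (g h : F) : phi (g * h)%g = phi g + phi h.
Proof.
elim/(@pres_ind _ (@norel 'I_n)): g => u; elim/(@pres_ind _ (@norel 'I_n)): h => v.
by rewrite [(_ * _)%g]pres_mulE !phi_pres_of /word_phi big_cat.
Qed.

Lemma phi1 : phi (1%g : F) = 0.
Proof. by apply: (addrI (phi (1%g : F))); rewrite -phiM mulg1 addr0. Qed.

Lemma phiV (g : F) : phi g^-1%g = - phi g.
Proof. by apply: (addrI (phi g)); rewrite -phiM mulgV phi1 subrr. Qed.

Lemma phi_gen i : phi (fgen i : F) = 1.
Proof. by rewrite phi_pres_of /word_phi big_seq1. Qed.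

Lemma phi_fhom (f : 'I_n -> F) g : (forall i, phi (f i) = 1) -> phi (fhom f g) = phi g.
Proof.
move=> f1; elim/(@pres_ind _ (@norel 'I_n)): g; elim=> [|[i b] u IH].
  by rewrite pres_of_nil (morphg1 (fhomM f)).
rewrite pres_of_cons fhomM !phiM IH; congr (_ + _).
by case: b => /=; rewrite ?(morphgV (fhomM f)) ?phiV fhom_gen f1 phi_gen.
Qed.

(** Each [artin_letter] sends generators to conjugates of generators. *)
Lemma phi_artin (b : braid n) g : phi (artin b g) = phi g.
Proof.
rewrite /artin; elim: (repr b : word _) g => [//|a u IH] g /=.
rewrite IH phi_fhom // => k; rewrite /artin_letter.
by case: (k == _); [|case: (k == _)]; case: a.2; rewrite ?phiM ?phiV !phi_gen.
Qed.

End Phi.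

(** * Tensor products over the group ring *)

Section L2Action.
Variables (R : realType) (n : nat) (G : groupType).
Local Notation C := R[i].
Local Notation F := (freegroup n).
Local Notation ZF := {freeg (freegroup n) / int}.

Lemma bopB (T : bop R G) (a b : l2 R G) : T (a - b) = T a - T b.
Proof.
have [lin _] := bopP T.
by rewrite [a - b]addrC -[- b]scaleN1r lin scaleN1r addrC.
Qed.

Lemma bop0 (T : bop R G) : T 0 = 0.
Proof. by rewrite -[X in T X](subrr 0) bopB subrr. Qed.

(** A sum over the support of [w] is not visibly additive in [w]; an [fglift] is. *)
Lemma RfunE (w : {freeg G / C}) (f : G -> C) x :
  Rfun w f x = fglift (fun h => f (x * h^-1)%g : C^o) w.
Proof. by rewrite -{2}[w]Freeg_dom fglift_Freeg /prelift big_map. Qed.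

Lemma RfunB (v w : {freeg G / C}) f x : Rfun (v - w) f x = Rfun v f x - Rfun w f x.
Proof. by rewrite !RfunE; exact: (@lift_is_additive C G C^o). Qed.

Lemma RfunU c g f x : Rfun (<< c *g g >> : {freeg G / C}) f x = c * f (x * g^-1)%g.
Proof. by rewrite RfunE liftU. Qed.

Lemma coeff_gring_complex g (w : {freeg G / R}) :
  coeff g (gring_complex w) = (coeff g w)%:C%C.
Proof.
rewrite /gring_complex raddf_sum /=.
under eq_bigr => k _ do rewrite coeffU.
have [gw|gw] := boolP (g \in dom w).
  rewrite (bigD1_seq g) ?uniq_dom //= eqxx mulr1 big1 ?addr0 // => k kg.
  by rewrite (negbTE kg) mulr0.
rewrite (coeff_outdom gw) big1_seq // => k /andP[_ kw].
by case: eqP => [kg|]; rewrite ?mulr0 //; rewrite kg in kw; rewrite kw in gw.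
Qed.

Lemma gring_complexB (v w : {freeg G / R}) :
  gring_complex (v - w) = gring_complex v - gring_complex w.
Proof.
apply/eqP/freeg_eqP => g.
by rewrite coeffB !coeff_gring_complex coeffB rmorphB.
Qed.

Lemma gring_complexU c g :
  gring_complex (<< c *g g >> : {freeg G / R}) = << c%:C%C *g g >>.
Proof.
apply/eqP/freeg_eqP => k.
by rewrite coeff_gring_complex !coeffU rmorphM rmorph_nat.
Qed.

Section Fixed.
Variables (gam : F -> G) (t : R).

Lemma l2act_subl a b r : l2act gam t (a - b) r = l2act gam t a r - l2act gam t b r.
Proof. exact: bopB. Qed.

Lemma l2actB a r s : l2act gam t a (r - s) = l2act gam t a r - l2act gam t a s.
Proof.
apply: val_inj; apply/funext => x /=.
by rewrite /kappa raddfB gring_complexB RfunB.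
Qed.

Lemma l2act0 a : l2act gam t a 0 = 0.
Proof. by rewrite -[X in l2act _ _ _ X](subrr 0) l2actB subrr. Qed.

Lemma l2actD a r s : l2act gam t a (r + s) = l2act gam t a r + l2act gam t a s.
Proof. by rewrite -[s in LHS]opprK l2actB -[- s]sub0r l2actB l2act0 sub0r opprK. Qed.

Lemma l2actU a g x :
  l2act gam t a << g >> x = (t ^ phi g)%:C%C * a (x * (gam g)^-1)%g.
Proof. by rewrite /l2act /kappa zliftU gring_complexU /= RfunU. Qed.

Hypothesis t_gt0 : 0 < t.
Hypothesis gamM : {morph gam : g h / (g * h)%g}.

Lemma l2act1 a : l2act gam t a << 1%g >> = a.
Proof.
apply: val_inj; apply/funext => x.
by rewrite [LHS]l2actU phi1 expr0z mul1r (morphg1 gamM) invg1 mulg1.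
Qed.

(** Right translation by [g] and then by [h] is right translation by [g h]; [0 < t] lets the integer
    powers of [t] multiply. *)
Lemma l2act_gmul a r s : l2act gam t a (gmul r s) = l2act gam t (l2act gam t a r) s.
Proof.
elim/freeg_int_ind: r => [|u v eu ev|g].
- by rewrite gmul0l !l2act0 /l2act bop0.
- by rewrite gmulBl !l2actB l2act_subl eu ev.
rewrite gmulU; elim/freeg_int_ind: s => [|u v eu ev|h].
- by rewrite raddf0 !l2act0.
- by rewrite raddfB !l2actB eu ev.
apply: val_inj; apply/funext => x.
rewrite ltransU [LHS]l2actU [RHS]l2actU l2actU phiM gamM invgM mulgA mulrA.
by rewrite expfzDr ?gt_eqF // [t ^ _ * _]mulrC rmorphM.
Qed.

End Fixed.

(** As [h] preserves [phi], the weights [t ^ phi g] do not change. This makes the map induced by the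
    lift of [H] compatible with the two balancing relations. *)
Lemma l2act_zlift (gam : F -> G) (t : R) (h : F -> F) a r : (forall g, phi (h g) = phi g) ->
  l2act (gam \o h) t a r = l2act gam t a (zlift (fun g => << h g >>) r).
Proof.
move=> hphi; rewrite /l2act; congr (Rop (gring_complex _) _).
rewrite /kappa zlift_comp; apply: eq_in_zlift => g _ /=.
by rewrite hphi.
Qed.

End L2Action.

(** * Universal property of the tensor product *)

Section TensorTheory.
Variables (V W : zmodType) (S : Type) (ra : V -> S -> V) (la : S -> W -> W).
Local Notation pure := (pure ra la).

Lemma pureDl a b c : pure (a + b) c = pure a c + pure b c.
Proof.
apply/eqP; rewrite -subr_eq0 opprD addrA -!raddfB; apply/eqP.
rewrite -[RHS](raddf0 \pi_(tensor ra la)); apply/eqP.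
rewrite -Quotient.idealrBE subr0; apply/asboolP; exact: tens_addl.
Qed.

Lemma pureDr a c d : pure a (c + d) = pure a c + pure a d.
Proof.
apply/eqP; rewrite -subr_eq0 opprD addrA -!raddfB; apply/eqP.
rewrite -[RHS](raddf0 \pi_(tensor ra la)); apply/eqP.
rewrite -Quotient.idealrBE subr0; apply/asboolP; exact: tens_addr.
Qed.

Lemma pure_balance a r c : pure (ra a r) c = pure a (la r c).
Proof.
apply/eqP; rewrite -Quotient.idealrBE; apply/asboolP; exact: tens_balance.
Qed.

Lemma pure0l c : pure 0 c = 0.
Proof. by apply: (addrI (pure 0 c)); rewrite -pureDl !addr0. Qed.

Lemma pure0r a : pure a 0 = 0.
Proof. by apply: (addrI (pure a 0)); rewrite -pureDr !addr0. Qed.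

Lemma pure_suml (I : finType) (a : I -> V) c :
  pure (\sum_i a i) c = \sum_i pure (a i) c.
Proof. by apply: (big_morph (pure^~ c)) => [u v|]; [exact: pureDl|exact: pure0l]. Qed.

Lemma pure_sumr (I : finType) a (c : I -> W) :
  pure a (\sum_i c i) = \sum_i pure a (c i).
Proof. by apply: (big_morph (pure a)) => [u v|]; [exact: pureDr|exact: pure0r]. Qed.

Variables (M : zmodType) (f : V -> W -> M).
Hypothesis fDl : forall a b c, f (a + b) c = f a c + f b c.
Hypothesis fDr : forall a c d, f a (c + d) = f a c + f a d.
Hypothesis f_balance : forall a r c, f (ra a r) c = f a (la r c).

(** [tensor_map] is by conversion the instance [f a c = pure a (tau c)]. *)
Definition tensor_lift (u : tensor ra la) : M :=
  zlift (fun ac : V * W => f ac.1 ac.2) (repr u).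

Lemma tensor_lift_pi v :
  tensor_lift (\pi_(tensor ra la) v) = zlift (fun ac : V * W => f ac.1 ac.2) v.
Proof.
have : repr (\pi_(tensor ra la) v) - v \in tens_relb ra la.
  by rewrite Quotient.idealrBE reprK.
move=> /asboolP rel; apply/eqP; rewrite -subr_eq0 -raddfB; apply/eqP.
elim: rel => [|u w _ eu _ ew|a b c|a c d|a r c].
- by rewrite raddf0.
- by rewrite raddfB eu ew subrr.
- by rewrite !raddfB /= !zliftU /= fDl addrAC addrK subrr.
- by rewrite !raddfB /= !zliftU /= fDr addrAC addrK subrr.
- by rewrite raddfB /= !zliftU /= f_balance subrr.
Qed.

Lemma tensor_liftB : zmod_morphism tensor_lift.
Proof.
move=> u v; rewrite -[u]reprK -[v]reprK -[_ - _]raddfB !tensor_lift_pi.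
exact: raddfB.
Qed.

Lemma tensor_lift_pure a c : tensor_lift (pure a c) = f a c.
Proof. by rewrite [LHS]tensor_lift_pi zliftU. Qed.

Lemma tensor_lift_sum (I : finType) (u : I -> tensor ra la) :
  tensor_lift (\sum_i u i) = \sum_i tensor_lift (u i).
Proof.
have T0 : tensor_lift 0 = 0 by rewrite -[X in tensor_lift X](subrr 0) tensor_liftB subrr.
apply: (big_morph tensor_lift) => // v w.
by rewrite -[w in LHS]opprK tensor_liftB -[- w]sub0r tensor_liftB T0 sub0r opprK.
Qed.

End TensorTheory.

(** * The matrix of a map on a module embedded in the group ring *)

Section FoxMatrix.
Variables (R : realType) (n : nat) (G : groupType).
Local Notation F := (freegroup n).
Local Notation ZF := {freeg (freegroup n) / int}.
Variables (gam : F -> G) (t : R).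
Hypothesis gamM : {morph gam : g h / (g * h)%g}.
Hypothesis t_gt0 : 0 < t.
Variable h : F -> F.
Hypothesis hM : {morph h : g k / (g * k)%g}.
Hypothesis phi_h : forall g, phi (h g) = phi g.

Variables (W : zmodType) (actW : ZF -> W -> W) (eta : W -> ZF).
Hypothesis etaB : zmod_morphism eta.
Hypothesis eta_inj : injective eta.
Hypothesis deg_eta : forall c, deg (eta c) = 0.
Hypothesis eta_act : forall r c, eta (actW r c) = gmul r (eta c).
Variable e : 'I_n -> W.
Hypothesis eta_e : forall i, eta (e i) = << fgen i >> - << 1%g >>.
Variable tau : W -> W.
Local Notation hZ := (zlift (fun g : F => << h g >> : ZF)).
Hypothesis eta_tau : forall c, eta (tau c) = hZ (eta c).

Let eta0 : eta 0 = 0.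
Proof. by rewrite -[X in eta X](subrr 0) etaB subrr. Qed.

Let etaD c d : eta (c + d) = eta c + eta d.
Proof. by rewrite -[d in LHS]opprK etaB -[- d]sub0r etaB eta0 sub0r opprK. Qed.

Let eta_sum (c : 'I_n -> W) : eta (\sum_i c i) = \sum_i eta (c i).
Proof. exact: (big_morph eta etaD eta0). Qed.

Lemma hZ_gmul r y : hZ (gmul r y) = gmul (hZ r) (hZ y).
Proof.
elim/freeg_int_ind: r => [|u v eu ev|g].
- by rewrite gmul0l !raddf0 gmul0l.
- by rewrite gmulBl !raddfB /= gmulBl eu ev.
rewrite gmulU zliftU gmulU; elim/freeg_int_ind: y => [|u v eu ev|k].
- by rewrite !raddf0.
- by rewrite !raddfB /= eu ev.
- by rewrite ltransU !zliftU ltransU hM.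
Qed.

Lemma tauD c d : tau (c + d) = tau c + tau d.
Proof. by apply: eta_inj; rewrite etaD !eta_tau etaD raddfD. Qed.

Lemma tau_act r c : tau (actW r c) = actW (hZ r) (tau c).
Proof. by apply: eta_inj; rewrite !(eta_tau, eta_act) hZ_gmul. Qed.

(** Under [eta] the left side is [h (x_j) - 1], which [fox_fundamental] expands. *)
Lemma tau_basis j : tau (e j) = \sum_i actW (fox i << h (fgen j) >>) (e i).
Proof.
apply: eta_inj; rewrite eta_tau eta_e raddfB /= !zliftU (morphg1 hM) eta_sum.
under eq_bigr => i _ do rewrite eta_act eta_e.
by rewrite fox_fundamental.
Qed.

Definition fox_matrix : 'M[{freeg G / R[i]}]_n :=
  \matrix_(i, j) gring_complex (kappa gam t (fox i << h (fgen j) >>)).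

Local Notation pureG := (pure (l2act gam t) actW).
Local Notation pureGh := (pure (l2act (gam \o h) t) actW).
Local Notation tau2 := (@tensor_map _ _ _ _ (l2act (gam \o h) t) (l2act gam t)
  actW actW tau).

Lemma fox_matrixE (a : 'I_n -> l2 R G) :
  tau2 (\sum_j pureGh (a j) (e j)) =
  \sum_i pureG (\sum_j Rmx fox_matrix i j (a j)) (e i).
Proof.
rewrite [LHS](tensor_lift_sum (f := fun a c => pureG a (tau c))); last first.
- move=> {}a r c; rewrite l2act_zlift // tau_act; exact: pure_balance.
- by move=> {}a c d; rewrite tauD pureDr.
- by move=> {}a b c; rewrite pureDl.
under eq_bigr => j _.
  rewrite (tensor_lift_pure (f := fun a c => pureG a (tau c))); last first.
  - by move=> {}a' r c; rewrite l2act_zlift // tau_act; exact: pure_balance.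
  - by move=> {}a' c d; rewrite tauD pureDr.
  - by move=> {}a' b c; rewrite pureDl.
  rewrite tau_basis pure_sumr.
  over.
rewrite exchange_big; apply: eq_bigr => i _ /=.
rewrite pure_suml; apply: eq_bigr => j _.
(* Balancing moves each Fox derivative to the left factor, where it acts as an entry of
   [Rmx fox_matrix]. *)
by rewrite -pure_balance !mxE.
Qed.

Lemma basis_coord_inj (a b : 'I_n -> l2 R G) :
  \sum_i pureG (a i) (e i) = \sum_i pureG (b i) (e i) -> a =1 b.
Proof.
(* This functional respects balancing because [fox i] is linear over the group ring in degree 0,
   where [eta] takes its values. *)
move=> ab i; pose f a c := l2act gam t a (fox i (eta c)).
have fDl u v c : f (u + v) c = f u c + f v c.
  have [lin _] := bopP (Rop (gring_complex (kappa gam t (fox i (eta c))))).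
  by rewrite -[u]scale1r [LHS]lin !scale1r.
have fDr u c d : f u (c + d) = f u c + f u d.
  by rewrite /f etaD raddfD l2actD.
have fb u r c : f (l2act gam t u r) c = f u (actW r c).
  by rewrite /f eta_act fox_gmul // l2act_gmul.
have coord (u : 'I_n -> l2 R G) :
    tensor_lift f (\sum_i pureG (u i) (e i)) = u i.
  rewrite tensor_lift_sum //.
  under eq_bigr => j _ do rewrite tensor_lift_pure //.
  rewrite (bigD1 i) //= big1 ?addr0 /f => [|j ji]; rewrite eta_e raddfB /= fox_gen.
    by rewrite eqxx -(pres_of_nil n) foxE /= subr0 l2act1.
  by rewrite (negbTE ji) -(pres_of_nil n) foxE /= subr0 l2act0.
by rewrite -(coord a) ab coord.
Qed.

Lemma fox_matrix_unique (M : 'M[bop R G]_n) :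
  (forall a : 'I_n -> l2 R G, tau2 (\sum_j pureGh (a j) (e j)) =
     \sum_i pureG (\sum_j M i j (a j)) (e i)) ->
  M = Rmx fox_matrix.
Proof.
move=> MP; apply/matrixP => i j; apply/bop_eqP => f.
(* A family concentrated at [j] isolates column [j]. *)
pose a k := if k == j then f else 0.
have aE (N : 'M[bop R G]_n) : \sum_k N i k (a k) = N i j f.
  rewrite (bigD1 j) //= big1 ?addr0 /a ?eqxx // => k kj.
  by rewrite (negbTE kj) bop0.
rewrite -!aE; move: i {aE}; apply: basis_coord_inj.
by rewrite -MP fox_matrixE.
Qed.

End FoxMatrix.

(** * From the punctured disk to the group ring *)

Theorem proposition4p2 (R : realType) (n : nat)
  (p : 'I_n -> R) (p_punctures : punctures p)
  (z : disk p) (x : 'I_n -> R -> disk p) (x_std : standard_loops z x)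
  (E : topologicalType) (pr : E -> disk p) (pr_cover : universal_cover R pr)
  (z0 : E) (pr_z0 : pr z0 = z)
  (act : freegroup n -> continuousType E E) (act_deck : deck_action pr z x z0 act)
  (xt : 'I_n -> continuousType (stdsimplex R 1) E)
  (xt_lift : forall i, simplex_lift pr z0 (x i) (xt i))
  (beta : braid n)
  (H : disk p -> disk p) (H_beta : represents z x H beta)
  (Ht : continuousType E E) (Ht_lift : forall e, pr (Ht e) = H (pr e))
  (Ht_z0 : Ht z0 = z0)
  (t : R) (t_gt0 : 0 < t)
  (G : groupType) (G_countable : countable [set: G])
  (gam : {multiplicative freegroup n -> G})
  (gam_phi : exists psi : G -> int,
     {morph psi : g h / (g * h)%g >-> g + h} /\ forall w, psi (gam w) = phi w) :
  let A : 'M[{freeg G / R[i]}]_n :=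
    \matrix_(i, j) gring_complex (kappa gam t (fox i << artin beta (fgen j) >>)) in
  L2Burau act beta Ht (fun i => hclass (pr @^-1` [set z]) << xt i >>) gam t = Rmx A.
Proof.
have [_ x_loop _ loops_surj loops_inj] := x_std.
have {x_loop} x_loop i : is_path (x i) z z by have [] := x_loop i.
have [pr_cov _ E_sc] := pr_cover.
have [act1 actM pr_act _] := act_deck.
have [_ _ H_loop] := H_beta.
set A := pr @^-1` [set z].
(* A path in the fibre lifts a constant path, as does the constant path at its start. *)
have A_discrete (c : R -> E) : continuous c ->
    (forall r, 0 <= r <= 1 -> A (c r)) -> c 0 = c 1.
  move=> cc Ac; apply/esym.
  apply: (lift_unique pr_cov (d := cst (c 0)) cc) => //.
  - exact: cst_continuous.
  - by move=> r /Ac ->; rewrite Ac // lexx ler01.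
  - by rewrite lexx ler01.
have actA g e : A e -> A (act g e) by rewrite /A /= pr_act.
have A_z0 w : A (act w z0) by rewrite /A /= pr_act.
have trans e : A e -> exists w, act w z0 = e.
  by move=> Ae; exact: (act_trans pr_cov pr_z0 act_deck E_sc loops_surj Ae).
have free := act_free pr_cov pr_z0 act_deck E_sc loops_inj.
have HtE w : Ht (act w z0) = act (artin beta w) z0.
  by apply: (@lift_act _ _ _ _ _ _ _ _ _ pr_cov act_deck H Ht (artin beta)) => //; exact: cts_fun.
have HtA e : A e -> A (Ht e) by move=> /trans[w <-]; rewrite HtE.
(* The inverse of [w |-> act w z0], with default value 1 off the fibre. *)
pose d e := xget 1%g [set w | act w z0 = e].
have dK w : d (act w z0) = w.
  by apply: free; exact: (@xgetI _ 1%g [set v | act v z0 = act w z0] w).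
have actd e : A e -> act (d e) z0 = e by move=> /trans[w <-]; rewrite dK.
pose eta (c : rel_H1 R A) := zlift (fun e => << d e >> : {freeg _ / int}) (rel_ends c).
have etaB : zmod_morphism eta by move=> u v; rewrite /eta rel_endsB // raddfB.
have eta_inj : injective eta.
  move=> u v uv; apply: (rel_ends_inj A_discrete z0 E_sc).
  (* [act] undoes [d] on the fibre, where the ends of relative cycles lie. *)
  have ends_eta c : zlift (fun w => << act w z0 >> : {freeg E / int}) (eta c) = rel_ends c.
    rewrite -[RHS]zlift_id /eta zlift_comp; apply: eq_zlift_rel_ends => e Ae /=.
    by rewrite actd.
  by rewrite -ends_eta uv ends_eta.
have deg_eta c : deg (eta c) = 0 by rewrite deg_zlift deg_rel_ends.
have eta_push (f : continuousType E E) h c : (forall e, A e -> A (f e)) ->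
    (forall e, A e -> d (f e) = h (d e)) ->
    eta (hpush A f c) = zlift (fun g => << h g >>) (eta c).
  move=> fA fd; rewrite /eta rel_ends_hpush // !zlift_comp.
  by apply: eq_zlift_rel_ends => e Ae /=; rewrite fd.
have dact g e : A e -> d (act g e) = (g * d e)%g.
  by move=> /trans[w <-]; rewrite -actM !dK.
have eta_act r c : eta (H1act act r c) = gmul r (eta c).
  rewrite /H1act; elim/freeg_int_ind: r => [|u v eu ev|g].
  - by rewrite raddf0 gmul0l /eta -[X in rel_ends X](subrr 0) rel_endsB // subrr raddf0.
  - by rewrite raddfB /= etaB gmulBl eu ev.
  - rewrite zliftU gmulU; apply: eta_push => e Ae; first exact: actA.
    exact: dact.
have eta_tau c : eta (hpush A Ht c) = zlift (fun g => << artin beta g >>) (eta c).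
  by apply: eta_push => [//|e /trans[w <-]]; rewrite HtE !dK.
have d_z0 : d z0 = 1%g by rewrite -[X in d X]act1 dK.
have eta_e i : eta (hclass A << xt i >>) = << fgen i >> - << 1%g >>.
  have [xt_pr xt0] := xt_lift i.
  have x0 : simplex_path (xt i) 0 = z0.
    by rewrite /simplex_path xt0 // edge_pointK // lexx ler01.
  have x1 : simplex_path (xt i) 1 = act (fgen i) z0.
    apply: (act_gen pr_cov x_loop pr_z0 act_deck); exists (simplex_path (xt i)).
    split=> [|r]; first by rewrite -{1}x0; exact/continuous_is_path/simplex_path_continuous.
    by rewrite itv01 => r01; rewrite /simplex_path xt_pr edge_pointK.
  have hx : rel_ends (hclass A << xt i >>) = << act (fgen i) z0 >> - << z0 >>.
    rewrite -x1 -[in RHS]x0; apply: hclass_simplex => //.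
      by rewrite x0 -[z0]act1.
    by rewrite x1.
  by rewrite /eta hx raddfB /= !zliftU dK d_z0.
have artin_betaM : {morph artin beta : g k / (g * k)%g}.
  by move=> g k; exact: artin_wordM.
have gamM : {morph gam : g k / (g * k)%g} by exact: gmulfM.
(* The choice made by [xget] is settled by exhibiting one matrix of the map and showing that it is
   the only one. *)
move=> M; apply: xget_unique => [a|N NP].
  exact: (fox_matrixE _ _ artin_betaM (phi_artin beta)
    etaB eta_inj eta_act eta_e eta_tau).
exact: (fox_matrix_unique gamM t_gt0 artin_betaM (phi_artin beta)
  etaB eta_inj deg_eta eta_act eta_e eta_tau NP).
Qed.
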